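(* Let $u,v$ be real numbers satisfying $\sqrt3\leq u\leq v\leq u+2/u$ or $\sqrt3\leq v\leq u\leq v+2/v$, and put $$\gamma=2\sqrt{1+\frac uv}\,\cos\left(\frac13\left[\pi-\arctan\left(\sqrt{\frac uv}\right)\right]\right)-1.$$ For any random variable $Z$ with mean $0$ and variance $1$ whose distribution is unimodal with mode at $0$, the inequality $$P(Z\leq -u \text{ or } Z\geq v)\leq \frac{1024\,v^{-2}+27(\gamma-1)^2(\gamma+3)^2}{9(\gamma+3)^3(3\gamma+1)}$$ holds. Equality is attained for $Z=UY$ with $U$ and $Y$ independent random variables, $U$ uniform on the unit interval, and $Y$ taking the values $$-\gamma c,\qquad \tfrac34(1-\gamma)c,\qquad c$$ with probabilities $$3\,\frac{4c^{-2}-\gamma+1}{(\gamma+1)(\gamma+3)},\qquad 16\,\frac{\gamma-3c^{-2}}{(\gamma+3)(3\gamma+1)},\qquad 3\,\frac{4c^{-2}+\gamma(\gamma-1)}{(\gamma+1)(3\gamma+1)},$$ respectively, where $c=\frac38(\gamma+3)v$.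
   Context: A distribution on $\mathbb{R}$ is unimodal with mode at $M$ if its distribution function is convex on $(-\infty,M)$ and concave on $[M,\infty)$. (A unimodal distribution may thus have an atom, but only at the mode $M$.) *)

(* Defs.v *)
From HB Require Import structures.
From mathcomp Require Import all_boot all_order all_algebra.
From mathcomp Require Import all_classical all_reals all_analysis.

Set Implicit Arguments.
Unset Strict Implicit.
Unset Printing Implicit Defensive.

Import Order.TTheory GRing.Theory Num.Theory.
Import numFieldNormedType.Exports.

Local Open Scope classical_set_scope.
Local Open Scope ring_scope.

Section random_variables.
Context {d : measure_display} {T : measurableType d} {R : realType}.
Variable P : probability T R.

(* The distribution of X is unimodal with mode at M. The extended real cdf X x
   is a probability, hence finite, so [fine] loses no information. Concavity of
   the distribution function is convexity of its opposite. *)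
Definition unimodal (X : {RV P >-> R}) (M : R) : Prop :=
  @convex_function R R^o `]-oo, M[%classic (fun x => fine (cdf X x)) /\
  @convex_function R R^o `[M, +oo[%classic (fun x => - fine (cdf X x)).

Definition independent_RVs (X Y : {RV P >-> R}) : Prop :=
  forall A B : set R, measurable A -> measurable B ->
    P (X @^-1` A `&` Y @^-1` B) = (P (X @^-1` A) * P (Y @^-1` B))%E.

(* Measures of the library are unconstrained outside the measurable sets,
   hence the restriction to measurable A. *)
Definition uniform01 (U : {RV P >-> R}) : Prop :=
  forall A : set R, measurable A ->
    distribution P U A = uniform_prob (@ltr01 R) A.

(* Y almost surely takes one of the values y1, y2, y3, and takes them with
   probabilities p1, p2, p3 (for pairwise distinct values). *)
Definition three_point (Y : {RV P >-> R}) (y1 p1 y2 p2 y3 p3 : R) : Prop :=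
  [/\ P [set w | Y w = y1] = p1%:E,
      P [set w | Y w = y2] = p2%:E,
      P [set w | Y w = y3] = p3%:E &
      {ae P, forall w, [\/ Y w = y1, Y w = y2 | Y w = y3]}].

Definition extremal_pair (gamma c : R) (U Y : {RV P >-> R}) : Prop :=
  [/\ uniform01 U,
      three_point Y
        (- gamma * c)
        (3 * ((4 * c ^- 2 - gamma + 1) / ((gamma + 1) * (gamma + 3))))
        (3 / 4 * (1 - gamma) * c)
        (16 * ((gamma - 3 * c ^- 2) / ((gamma + 3) * (3 * gamma + 1))))
        c
        (3 * ((4 * c ^- 2 + gamma * (gamma - 1))
                / ((gamma + 1) * (3 * gamma + 1)))) &
      independent_RVs U Y].

End random_variables.

(* Main.v *)
Require Import Defs.
From HB Require Import structures.
From mathcomp Require Import all_boot all_order all_algebra.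
From mathcomp Require Import all_classical all_reals all_analysis.
From mathcomp Require Import measurable_realfun ring lra.

Set Implicit Arguments.
Unset Strict Implicit.
Unset Printing Implicit Defensive.

Import Order.TTheory GRing.Theory Num.Theory.
Import numFieldNormedType.Exports.

Local Open Scope classical_set_scope.
Local Open Scope ring_scope.

(** Write [g] for [gamma] and put [m = 3/4 (1 - g) c], [k = 2 v / (c^3 (3 g + 1))],
    [q y = k (y - m)^2] and [h z = k (3 z - m) (z - m)], which is the derivative
    of [y q y].  If [Z] has mean 0 and variance 1, then
    [E h(Z) = k (3 + m^2)], and this number is the bound of the theorem
    ([tangency_bound]).  The inequality thus says [E phi(Z) >= 0] for
    [phi = h - 1_tail], where the tail is [z <= - u] or [z >= v].

    The average of [1_tail] between 0 and [y] is [1 - v / y] for [y > v],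
    [1 - u / |y|] for [y < - u] and 0 in between, while the average of [h] is
    [q y].  The parabola [q] lies above the former function and touches it at
    the three points [- g c], [m] and [c].  Requiring the two outer contacts
    determines [c] and imposes the cubic equation
    [g^2 (g + 3) v = u (3 g + 1)], of which the trigonometric expression for
    [g] is a root ([gamma_cubic]).

    On the positive half-line the signs of [phi] are [+] on [(0, m/3)],
    [-] on [(m/3, m)], [+] on [(m, v)], [-] on [(v, c)] and [+] after [c], the
    first two intervals being absent if [m <= 0]; because of the contacts at
    [m] and [c], the Lebesgue integral of [phi] vanishes over each block made
    of a [+] interval and the following [-] interval.  A unimodal law has a
    nonincreasing density there, so that it favours the [+] part of each block.
    No density is constructed: if the block changes sign at [b], a supporting
    slope [s] of the concave distribution function at [b] makes the law at least
    [s] times the Lebesgue measure before [b] and at most that after [b]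
    ([unimodal_right_law]).  Such comparisons are evident on intervals and
    extend to Borel sets since a Lebesgue-Stieltjes measure is an infimum over
    covers by intervals ([le_lebesgue_stieltjes_measure]).  This proves the
    half-line estimate [unimodal_right_test_function].  The negative half-line
    is the positive half-line of the law of [- Z], with [v], [c], [m] replaced by
    [u], [g c], [- m].

    For [Z = U Y] the law of [Z] is a mixture of three uniform laws on the
    intervals between 0 and the atoms of [Y] ([law_mixture]).  These atoms are
    the contact points, so that the tail probability is [E q(Y)], which equals
    [k (3 + m^2)] because [E Y = 0] and [E Y^2 = 3]. *)

(** * The cubic equation for gamma *)

Lemma cos_triple (R : realType) (t : R) : cos (3 * t) = 4 * cos t ^+ 3 - 3 * cos t.
Proof.
rewrite (_ : 3 * t = t + t + t); last by ring.
rewrite cosD cosD sinD.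
have := sin2cos2 t; rewrite !expr2 => e.
rewrite exprS expr2.
rewrite (_ : sin t * cos t + cos t * sin t = 2 * sin t * cos t); last by ring.
rewrite (_ : (cos t * cos t - sin t * sin t) * cos t - 2 * sin t * cos t * sin t
  = cos t ^+ 3 - 3 * (sin t * sin t) * cos t); last by ring.
rewrite e; ring.
Qed.

(** With [r = u / v], [S = sqrt (1 + r)] and [th] the angle of the statement,
    [gamma + 1 = 2 S cos th] and [cos (3 th) = - 1 / S], so the triple angle
    formula is the equation of degree 3 for [gamma + 1] (the trigonometric
    solution of a cubic).  The root is positive because [th < pi / 3]. *)
Lemma gamma_cubic (R : realType) (u v gamma : R) : 0 < u -> 0 < v ->
  gamma = 2 * Num.sqrt (1 + u / v)
            * cos (1 / 3 * (pi - atan (Num.sqrt (u / v)))) - 1 ->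
  0 < gamma /\ gamma ^+ 2 * (gamma + 3) * v = u * (3 * gamma + 1).
Proof.
move=> u0 v0 hg.
set r := u / v in hg *.
have r0 : 0 < r by rewrite divr_gt0.
set S := Num.sqrt (1 + r) in hg.
have S2 : S ^+ 2 = 1 + r by rewrite sqr_sqrtr// addr_ge0// ltW.
have S1 : 1 < S by rewrite -sqrtr1 ltr_sqrt; lra.
set al := atan (Num.sqrt r) in hg.
have al0 : 0 < al by rewrite -(@atan0 R) lt_atan// sqrtr_gt0.
have alpi : al < pi / 2 by exact: atan_ltpi2.
have cosal : cos al = S^-1.
  by rewrite /al cos_atan sqr_sqrtr// ltW.
set th := 1 / 3 * (pi - al) in hg.
have th3 : 3 * th = pi - al by rewrite /th; field.
have pi0 : 0 < pi :> R := pi_gt0 R.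
have C3 : 4 * cos th ^+ 3 - 3 * cos th = - S^-1.
  by rewrite -cos_triple th3 addrC cosDpi cosN cosal.
have cth : 1 / 2 < cos th.
  have Hp : cos (pi / 3) = 1 / 2 :> R.
    have := cos_triple (pi / 3 : R).
    rewrite (_ : 3 * (pi / 3) = pi); last by field.
    rewrite cospi.
    have p0 : 0 < cos (pi / 3) :> R by apply: cos_gt0_pihalf; apply/andP; split; lra.
    move=> e; have : (2 * cos (pi / 3) - 1) ^+ 2 * (cos (pi / 3) + 1) = 0 :> R by lra.
    move/eqP; rewrite mulf_eq0 sqrf_eq0 => /orP[/eqP|/eqP]; lra.
  rewrite -Hp ltr_cos ?in_itv/=; [rewrite /th; lra| |];
    by rewrite ?/th; apply/andP; split; lra.
have S0 : S != 0 by lra.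
split; first nra.
have xe : 2 * S * cos th = gamma + 1 by rewrite hg; ring.
have cu : (gamma + 1) ^+ 3 - 3 * (1 + r) * (gamma + 1) + 2 * (1 + r) = 0.
  rewrite -xe -S2.
  rewrite (_ : _ - _ + _ = 2 * S ^+ 3 * (4 * cos th ^+ 3 - 3 * cos th + S^-1)); last by field.
  by rewrite C3; ring.
have ur : u = r * v by rewrite /r; field; lra.
clearbody r; rewrite ur.
apply/eqP; rewrite -subr_eq0; apply/eqP.
rewrite (_ : _ - _ = v * ((gamma + 1) ^+ 3 - 3 * (1 + r) * (gamma + 1) + 2 * (1 + r))); last by ring.
by rewrite cu mulr0.
Qed.

(** * The parabola and the three weights *)

(** This gives the sign of one of the two outer weights of [Y].  By the cubic,
    [v <= u + 2 / u] is a bound on [v^2] in terms of [g] alone, so that the claim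
    becomes a polynomial inequality in [g]. *)
Lemma weight_bound (R : realType) (u v g : R) : 0 < u -> 0 < v -> 0 < g ->
  g ^+ 2 * (g + 3) * v = u * (3 * g + 1) -> g < 1 ->
  (Num.sqrt 3 <= u /\ u <= v /\ v <= u + 2 / u) \/
  (Num.sqrt 3 <= v /\ v <= u /\ u <= v + 2 / v) ->
  g * (1 - g) * (3 / 8 * (g + 3) * v) ^+ 2 <= 4.
Proof.
move=> u0 v0 g0 cubic g1 huv.
have D0 : 0 < 3 * g + 1 by lra.
have vuD : (v - u) * (3 * g + 1) = v * ((1 - g) * (g ^+ 2 + 4 * g + 1)).
  by rewrite mulrBl -cubic; ring.
have uv : u < v.
  rewrite -subr_gt0 -(pmulr_lgt0 _ D0) vuD.
  by apply: mulr_gt0 => //; apply: mulr_gt0; nra.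
case: huv => -[s3u [vu' vu]]; last by lra.
have u3 : 3 <= u ^+ 2.
  by rewrite -[leLHS](@sqr_sqrtr R 3)// ler_sqr ?nnegrE ?sqrtr_ge0// ltW.
have uvu : u * (v - u) <= 2.
  rewrite mulrC -ler_pdivlMr//; lra.
have v53 : 3 * v <= 5 * u by nra.
(* The final polynomial inequality fails for [g] close to 0; the bound
   [v <= 5 u / 3] and the cubic exclude this. *)
have g12 : 1 / 2 <= g.
  rewrite leNgt; apply/negP => g12.
  have : 3 * (3 * g + 1) * v <= 5 * (g ^+ 2 * (g + 3)) * v.
    rewrite -mulrA -[leRHS]mulrA cubic; nra.
  rewrite ler_pM2r//; nra.
have key : v ^+ 2 * (g ^+ 2 * (g + 3) * (1 - g) * (g ^+ 2 + 4 * g + 1))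
    <= 2 * (3 * g + 1) ^+ 2.
  rewrite (_ : v ^+ 2 * _ = u * (v - u) * (3 * g + 1) ^+ 2).
    by rewrite ler_wpM2r// exprn_ge0// ltW.
  rewrite (_ : u * (v - u) * _ = (u * (3 * g + 1)) * ((v - u) * (3 * g + 1))); last by ring.
  by rewrite vuD -cubic; ring.
have K0 : 0 < 64 * (g * (g ^+ 2 + 4 * g + 1)).
  by apply: mulr_gt0 => //; apply: mulr_gt0 => //; nra.
rewrite -(ler_pM2l K0).
apply: (@le_trans _ _ (9 * (g + 3) * (2 * (3 * g + 1) ^+ 2))); last nra.
apply: (le_trans _ (ler_wpM2l (_ : 0 <= 9 * (g + 3)) key)); last by lra.
by rewrite le_eqVlt; apply/orP; left; apply/eqP; field.
Qed.

(** The data of the parabola [k (y - m)^2]: the cubic says that the parabola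
    which vanishes at [m] and touches [1 - v / y] at [c] also touches
    [1 - u / |y|] at [- g c]. *)
Record tangency (R : realType) (u v g c m k : R) : Prop := Tangency {
  tangency_u_gt0 : 0 < u ;
  tangency_v_gt0 : 0 < v ;
  tangency_g_gt0 : 0 < g ;
  tangency_cubic : g ^+ 2 * (g + 3) * v = u * (3 * g + 1) ;
  tangency_c : c = 3 / 8 * (g + 3) * v ;
  tangency_m : m = 3 / 4 * (1 - g) * c ;
  tangency_k : k = 2 * v / (c ^+ 3 * (3 * g + 1)) }.

Section tangency.
Context {R : realType}.
Variables u v g c m k : R.
Hypothesis H : tangency u v g c m k.

Lemma tangency_c_gt0 : 0 < c.
Proof. by case: H => u0 v0 g0 _ -> _ _; apply: mulr_gt0 => //; lra. Qed.

Lemma tangency_k_gt0 : 0 < k.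
Proof.
have c0 := tangency_c_gt0; case: H => u0 v0 g0 _ _ _ ->.
apply: divr_gt0; apply: mulr_gt0 => //; first exact: exprn_gt0.
lra.
Qed.

Lemma tangency_u : u = g ^+ 2 * (g + 3) * v / (3 * g + 1).
Proof. by case: H => u0 v0 g0 -> _ _ _; field; lra. Qed.

(** The third equation is [k (c - m)^2 = 1 - v / c]; the fourth says that
    [y k (y - m)^2] has slope 1 at [c], like [y - v]. *)
Lemma tangency_right : [/\ m < v, v < c, k * c * (c - m) ^+ 2 = c - v &
  k * (3 * c - m) * (c - m) = 1].
Proof.
case: H => u0 v0 g0 _ -> -> ->; split.
- nra.
- nra.
- by field; rewrite !gt_eqF//; lra.
- by field; rewrite !gt_eqF//; lra.
Qed.

(** The mirror image of [tangency_right] under [y |-> - y]: the roles of [v], [c]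
    and [m] are played by [u], [g c] and [- m]. *)
Lemma tangency_left : [/\ - m < u, u < g * c,
  k * (g * c) * (g * c - - m) ^+ 2 = g * c - u &
  k * (3 * (g * c) - - m) * (g * c - - m) = 1].
Proof.
have ue := tangency_u; case: H => u0 v0 g0 _ hc hm hk; split.
- rewrite ue ltr_pdivlMr; last lra.
  rewrite hm hc -subr_gt0.
  rewrite (_ : _ - _ = v * (g + 3) * ((5 * g ^+ 2 + 18 * g + 9) / 32)); last by field.
  by apply: mulr_gt0; [apply: mulr_gt0; lra|nra].
- rewrite ue ltr_pdivrMr; last lra.
  rewrite hc -subr_gt0.
  rewrite (_ : _ - _ = v * (g + 3) * (g * (g + 3) / 8)); last by field.
  by apply: mulr_gt0; [apply: mulr_gt0; lra|nra].
- by rewrite ue hk hm hc; field; rewrite !gt_eqF//; lra.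
- by rewrite hk hm hc; field; rewrite !gt_eqF//; lra.
Qed.

Lemma tangency_bound :
  (1024 * v ^- 2 + 27 * (g - 1) ^+ 2 * (g + 3) ^+ 2)
       / (9 * (g + 3) ^+ 3 * (3 * g + 1)) = k * (3 + m ^+ 2).
Proof.
case: H => u0 v0 g0 _ -> -> ->; field; rewrite !gt_eqF//; lra.
Qed.

Variables p1 p2 p3 : R.
Hypothesis hp1 : p1 = 3 * ((4 * c ^- 2 - g + 1) / ((g + 1) * (g + 3))).
Hypothesis hp2 : p2 = 16 * ((g - 3 * c ^- 2) / ((g + 3) * (3 * g + 1))).
Hypothesis hp3 : p3 = 3 * ((4 * c ^- 2 + g * (g - 1)) / ((g + 1) * (3 * g + 1))).

Lemma weights_sum : p1 + p2 + p3 = 1.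
Proof.
have c0 := tangency_c_gt0; case: H => u0 v0 g0 _ _ _ _.
by rewrite hp1 hp2 hp3; field; rewrite !gt_eqF//; lra.
Qed.

Lemma weights_mean : p1 * (- g * c) + p2 * m + p3 * c = 0.
Proof.
have c0 := tangency_c_gt0; case: H => u0 v0 g0 _ _ -> _.
by rewrite hp1 hp2 hp3; field; rewrite !gt_eqF//; lra.
Qed.

Lemma weights_second_moment :
  p1 * (- g * c) ^+ 2 + p2 * m ^+ 2 + p3 * c ^+ 2 = 3.
Proof.
have c0 := tangency_c_gt0; case: H => u0 v0 g0 _ _ -> _.
by rewrite hp1 hp2 hp3; field; rewrite !gt_eqF//; lra.
Qed.

(** The left-hand side is the mean of the parabola over the three atoms, because
    the parabola agrees with [1 - u / |y|] at [- g c], with 0 at [m] and with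
    [1 - v / y] at [c]. *)
Lemma weights_tail :
  p1 * (1 - u / (g * c)) + p3 * (1 - v / c) = k * (3 + m ^+ 2).
Proof.
have [_ _ hr _] := tangency_right; have [_ _ hl _] := tangency_left.
have c0 := tangency_c_gt0; have g0 := tangency_g_gt0 H.
have gc0 : 0 < g * c by exact: mulr_gt0.
rewrite (_ : 1 - u / (g * c) = k * (- g * c - m) ^+ 2); last first.
  apply: (mulfI (lt0r_neq0 gc0)).
  rewrite mulrBr mulr1 mulrCA mulfV ?lt0r_neq0// mulr1 -hl; ring.
rewrite (_ : 1 - v / c = k * (c - m) ^+ 2); last first.
  apply: (mulfI (lt0r_neq0 c0)).
  rewrite mulrBr mulr1 mulrCA mulfV ?lt0r_neq0// mulr1 -hr; ring.
rewrite (_ : _ + _ = k * ((p1 * (- g * c) ^+ 2 + p2 * m ^+ 2 + p3 * c ^+ 2)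
  - 2 * m * (p1 * (- g * c) + p2 * m + p3 * c)
  + m ^+ 2 * (p1 + p2 + p3))); last by ring.
by rewrite weights_sum weights_mean weights_second_moment; ring.
Qed.

(** The weight of the middle atom is nonnegative because [u v >= 3]; of the two
    other weights, one has a visible sign and the other one is controlled by
    [weight_bound]. *)
Lemma weights_ge0 :
  (Num.sqrt 3 <= u /\ u <= v /\ v <= u + 2 / u) \/
  (Num.sqrt 3 <= v /\ v <= u /\ u <= v + 2 / v) ->
  [/\ 0 <= p1, 0 <= p2 & 0 <= p3].
Proof.
move=> huv; have c0 := tangency_c_gt0; case: H => u0 v0 g0 cubic hc _ _.
have g2 : 3 <= g * c ^+ 2.
  have uv3 : 3 <= u * v.
    have s3 : Num.sqrt 3 * Num.sqrt 3 = 3 :> R by rewrite -expr2 sqr_sqrtr.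
    have s0 : 0 <= Num.sqrt 3 :> R by rewrite sqrtr_ge0.
    have su : Num.sqrt 3 <= u by case: huv => -[? [? ?]]; lra.
    have sv : Num.sqrt 3 <= v by case: huv => -[? [? ?]]; lra.
    by rewrite -s3 ler_pM.
  have e : 64 * g * (g * c ^+ 2) = 9 * (g + 3) * (3 * g + 1) * (u * v).
    rewrite (_ : 9 * _ * _ * _ = 9 * (g + 3) * v * (u * (3 * g + 1))); last by ring.
    by rewrite -cubic hc; field.
  have : 64 * g * 3 <= 64 * g * (g * c ^+ 2).
    rewrite e.
    apply: (@le_trans _ _ (9 * (g + 3) * (3 * g + 1) * 3)); first nra.
    by rewrite ler_wpM2l// !mulr_ge0//; lra.
  by rewrite ler_pM2l//; lra.
have c20 : 0 < c ^+ 2 by rewrite exprn_gt0.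
have iv (x : R) : x * c ^- 2 * c ^+ 2 = x by field; lra.
have h1 : (g - 1) * c ^+ 2 <= 4.
  have [g1|g1] := leP g 1; first nra.
  (* Exchanging [u] and [v] turns [g] into [1 / g] and [c] into [g c]. *)
  have := @weight_bound R v u g^-1 v0 u0; rewrite invr_gt0 invf_lt1// => /(_ g0).
  have -> : (g^-1 * (1 - g^-1) * (3 / 8 * (g^-1 + 3) * u) ^+ 2) = (g - 1) * c ^+ 2.
    by rewrite tangency_u hc; field; rewrite !gt_eqF//; lra.
  apply=> //; last by case: huv; [right|left].
  by rewrite tangency_u; field; rewrite !gt_eqF//; lra.
have h3 : g * (1 - g) * c ^+ 2 <= 4.
  have [g1|g1] := leP 1 g; first nra.
  by rewrite hc; exact: weight_bound cubic g1 huv.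
split.
- rewrite hp1 mulr_ge0// divr_ge0//; last by rewrite mulr_ge0//; lra.
  by rewrite -(pmulr_lge0 _ c20) !mulrDl iv; lra.
- rewrite hp2 mulr_ge0// divr_ge0//; last by rewrite mulr_ge0//; lra.
  by rewrite -(pmulr_lge0 _ c20) mulrBl iv; lra.
- rewrite hp3 mulr_ge0// divr_ge0//; last by rewrite mulr_ge0//; lra.
  by rewrite -(pmulr_lge0 _ c20) !mulrDl iv; lra.
Qed.

End tangency.

(** * Comparison of measures through intervals *)

Section interval_domination.
Context {R : realType}.
Local Open Scope ereal_scope.

(** [lebesgue_stieltjes_measure f A] is an infimum over the covers of [A] by
    half-open intervals, and [mu] is subadditive, so only intervals have to be
    compared. *)
Lemma le_lebesgue_stieltjes_measure (f : cumulative R R)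
    (mu : {measure set (measurableTypeR R) -> \bar R}) (D : set R) :
  measurable (D : set (measurableTypeR R)) ->
  (forall x y, (x < y)%R -> mu (`]x, y]%classic `&` D) <= (f y - f x)%:E) ->
  forall A : set (measurableTypeR R), measurable A -> A `<=` D ->
    mu A <= lebesgue_stieltjes_measure f A.
Proof.
move=> mD muD A mA AD.
apply: le_ereal_inf_tmp => _ [F [mF AF] <-].
have mF' n : measurable (F n : set (measurableTypeR R)).
  exact: sub_sigma_algebra.
have mFD n : measurable ((F n : set (measurableTypeR R)) `&` D).
  exact: measurableI.
apply: (@le_trans _ _ (\sum_(n <oo) mu (F n `&` D))).
  apply: measure_sigma_subadditive => //= t At.
  by have [n _ Fnt] := AF _ At; exists n => //; split => //; exact: AD.
apply: lee_nneseries => // n _.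
have [[a b] _ <-] /= := mF n.
have [ab|ba] := ltP a b; first by rewrite (wlength_itv_bnd _ _ _ (ltW ab)); exact: muD.
by rewrite set_itv_ge ?set0I ?measure0 ?wlength0// bnd_simp -leNgt.
Qed.

Lemma lebesgue_stieltjes_measure_itv_oc (f : cumulative R R) (x y : R) :
  (x <= y)%R -> lebesgue_stieltjes_measure f `]x, y]%classic = (f y - f x)%:E.
Proof.
move=> xy; rewrite [LHS]measurable_mu_extE/=; last exact: is_ocitv.
exact: wlength_itv_bnd.
Qed.

(* [s] times the Lebesgue measure as the Lebesgue-Stieltjes measure of the
   function [x |-> s x]. *)
Section scaled_identity.
Variable s : {nonneg R}.

Let sid (x : R) : R := (s%:num * x)%R.

Let sid_nd : nondecreasing sid.
Proof. by move=> x y xy; rewrite /sid ler_wpM2l. Qed.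

Let sid_rc : right_continuous sid.
Proof.
apply/right_continuousW => x; apply: (@cvgM _ R^o); [exact: cvg_cst|exact: cvg_id].
Qed.

HB.instance Definition _ := isCumulative.Build R _ R sid sid_nd sid_rc.

Lemma le_mscale_lebesgue
    (mu : {measure set (measurableTypeR R) -> \bar R}) (D : set R) :
  measurable (D : set (measurableTypeR R)) ->
  (forall x y, (x < y)%R ->
     mu (`]x, y]%classic `&` D) <= (s%:num * (y - x))%:E) ->
  forall A : set (measurableTypeR R), measurable A -> A `<=` D ->
    mu A <= s%:num%:E * lebesgue_measure A.
Proof.
move=> mD muD A mA AD.
have := @le_lebesgue_stieltjes_measure sid mu D mD.
move=> /(_ _ A mA AD); rewrite (_ : lebesgue_stieltjes_measure _ A =
   mscale s (@lebesgue_measure R) A); first apply.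
  by move=> x y xy; rewrite (le_trans (muD _ _ xy))// lee_fin /sid mulrBr.
apply: lebesgue_stieltjes_measure_unique => // _ [[a b] _ <-].
rewrite [RHS](_ : _ = s%:num%:E * @lebesgue_measure R `]a, b]%classic)//.
rewrite lebesgue_measure_itv/=.
have [ab|ba] := ltP a b.
  by rewrite (lebesgue_stieltjes_measure_itv_oc _ (ltW ab)) lte_fin ab /sid -mulrBr EFinM.
rewrite set_itv_ge; last by rewrite bnd_simp -leNgt.
by rewrite measure0 lte_fin ltNge ba mule0.
Qed.

End scaled_identity.

(** The converse comparison: here the upper measure is the Lebesgue-Stieltjes
    measure of its own distribution function. *)
Lemma mscale_lebesgue_le (P : probability (measurableTypeR R) R)
    (s : {nonneg R}) (D : set R) :
  measurable (D : set (measurableTypeR R)) ->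
  (forall x y, (x < y)%R ->
     s%:num%:E * lebesgue_measure (`]x, y]%classic `&` D) <= P `]x, y]%classic) ->
  forall A : set (measurableTypeR R), measurable A -> A `<=` D ->
    s%:num%:E * lebesgue_measure A <= P A.
Proof.
move=> mD sP A mA AD; rewrite -lebesgue_stieltjes_cdf_id//.
apply: (@le_lebesgue_stieltjes_measure _ (mscale s (@lebesgue_measure R)) D) => //.
move=> x y xy; rewrite -(lebesgue_stieltjes_measure_itv_oc _ (ltW xy)).
by rewrite lebesgue_stieltjes_cdf_id//; exact: sP.
Qed.

Lemma le_measure_ge0_integral d (T : measurableType d)
    (m1 m2 : {measure set T -> \bar R}) (D : set T) (f : T -> \bar R) :
  measurable D -> measurable_fun D f -> (forall x, D x -> 0 <= f x) ->
  (forall A, measurable A -> A `<=` D -> m1 A <= m2 A) ->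
  \int[m1]_(x in D) f x <= \int[m2]_(x in D) f x.
Proof.
move=> mD mf f0 m12.
rewrite (eq_measure_integral (mrestr m1 mD)); last first.
  by move=> A mA AD; rewrite /= /mrestr setIidl.
rewrite [leRHS](eq_measure_integral (mrestr m2 mD)); last first.
  by move=> A mA AD; rewrite /= /mrestr setIidl.
rewrite integral_mkcond [leRHS]integral_mkcond.
apply: ge0_le_measure_integral => //.
- by move=> A mA; apply: m12; [exact: measurableI|exact: subIsetr].
- by move=> x; exact: erestrict_ge0.
- by apply/(measurable_restrictT _ _).1.
Qed.


End interval_domination.

(** * Test function on a half-line with nonincreasing density *)

Section unimodal_right.
Context {R : realType}.
Local Open Scope ereal_scope.
Implicit Types mu : {measure set (measurableTypeR R) -> \bar R}.

(** A substitute for a nonincreasing density on the positive half-line, [s] being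
    the value of that density at [b].  Quantifying over Borel sets instead of
    half-open intervals makes the property easy to carry over to the law of the
    opposite variable. *)
Definition unimodal_right mu := forall b : R, (0 < b)%R ->
  exists s : {nonneg R},
    (forall A : set (measurableTypeR R), measurable A -> A `<=` `]0%R, b[ ->
       s%:num%:E * lebesgue_measure A <= mu A) /\
    (forall A : set (measurableTypeR R), measurable A -> A `<=` `]b, +oo[ ->
       mu A <= s%:num%:E * lebesgue_measure A).

(** Both integrals are compared with [s] times the Lebesgue integrals, where [s]
    is the density at the point [b] that separates [D1] from [D2]. *)
Lemma unimodal_right_transfer mu (b : R) (D1 D2 : set (measurableTypeR R))
    (f1 f2 : measurableTypeR R -> \bar R) :
  unimodal_right mu -> (0 < b)%R ->
  measurable D1 -> D1 `<=` `]0%R, b[ -> measurable D2 -> D2 `<=` `]b, +oo[ ->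
  measurable_fun setT f1 -> (forall x, 0 <= f1 x) ->
  measurable_fun setT f2 -> (forall x, 0 <= f2 x) ->
  \int[lebesgue_measure]_(x in D2) f2 x <= \int[lebesgue_measure]_(x in D1) f1 x ->
  \int[mu]_(x in D2) f2 x <= \int[mu]_(x in D1) f1 x.
Proof.
move=> uni b0 mD1 D1b mD2 D2b mf1 f10 mf2 f20 leb.
have [s [low up]] := uni _ b0.
apply: (@le_trans _ _ (\int[mscale s (@lebesgue_measure R)]_(x in D2) f2 x)).
  apply: le_measure_ge0_integral => //; first exact: measurable_funTS.
  by move=> A mA AD; apply: up => //; exact: subset_trans AD D2b.
apply: (@le_trans _ _ (\int[mscale s (@lebesgue_measure R)]_(x in D1) f1 x)).
  rewrite !ge0_integral_mscale//; [|exact: measurable_funTS..].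
  by apply: lee_wpmul2l.
apply: le_measure_ge0_integral => //; first exact: measurable_funTS.
by move=> A mA AD; apply: low => //; exact: subset_trans AD D1b.
Qed.

Lemma unimodal_right_set1 mu (v : R) : unimodal_right mu -> (0 < v)%R ->
  mu [set v] = 0.
Proof.
move=> uni v0; have v20 : (0 < v / 2)%R by rewrite divr_gt0.
have [s [_ up]] := uni _ v20.
apply/eqP; rewrite eq_le measure_ge0 andbT.
have := up [set v] (measurable_set1 v).
rewrite lebesgue_measure_set1 mule0; apply.
by move=> x /= ->; rewrite in_itv/= andbT ltr_pdivrMr// ltr_pMr// ltr1n.
Qed.

Lemma ge0_integral_itv_split mu (a x b : itv_bound R)
    (f : measurableTypeR R -> \bar R) : (a <= x)%O -> (x <= b)%O ->
  measurable_fun setT f -> (forall z, 0 <= f z) ->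
  \int[mu]_(z in [set` Interval a b]) f z =
  \int[mu]_(z in [set` Interval a x]) f z + \int[mu]_(z in [set` Interval x b]) f z.
Proof.
move=> ax xb mf f0; rewrite (itv_bndbnd_setU ax xb) ge0_integral_setU//.
- exact: measurable_funTS.
- rewrite disj_set2E; apply/eqP; rewrite -subset0 => z [/=].
  by rewrite !itv_boundlr => /andP[_ zx] /andP[xz _]; have := le_trans zx xz; rewrite bnd_simp ltxx.
Qed.

Lemma integral_deriv_poly (p : {poly R}) (x y : R) (b0 b1 : bool) : (x <= y)%R ->
  \int[lebesgue_measure]_(z in [set` Interval (BSide b0 x) (BSide b1 y)])
    (p^`().[z])%:E = (p.[y] - p.[x])%:E.
Proof.
have cp (q : {poly R}) : continuous (horner q).
  move=> z; apply/differentiable_continuous/derivable1_diffP.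
  by have [] := is_derive_poly q z.
move=> xy; rewrite integral_itv_bndoo; last first.
  apply: measurable_funTS; apply/measurable_EFinP.
  exact: continuous_measurable_fun.
move: xy; rewrite le_eqVlt => /predU1P[->|xy].
  by rewrite set_itvoo0 integral_set0 subrr.
rewrite -(@integral_itv_bndoo _ _ _ _ true false); last first.
  apply: measurable_funTS; apply/measurable_EFinP.
  exact: continuous_measurable_fun.
rewrite (@continuous_FTC2 _ _ (horner p))//.
- by apply: continuous_subspaceT => z; exact: cp.
- split.
  + by move=> z _; have [] := is_derive_poly p z.
  + by apply: cvg_at_right_filter; exact: cp.
  + by apply: cvg_at_left_filter; exact: cp.
- by move=> z _; rewrite derive1E; have [_ ->] := is_derive_poly p z.
Qed.

End unimodal_right.

Section half_line.
Context {R : realType}.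
Local Open Scope ereal_scope.
Variables k m : R.

(** The derivative of [z k (z - m)^2]. *)
Definition test_function (z : R) : R := (k * (3 * z - m) * (z - m))%R.

Let primitive : {poly R} := k *: ('X * ('X - m%:P) ^+ 2).

Let primitiveE (z : R) : primitive.[z] = (k * z * (z - m) ^+ 2)%R.
Proof. by rewrite /primitive !hornerE; ring. Qed.

Let deriv_primitiveE (z : R) : (primitive^`()).[z] = test_function z.
Proof.
rewrite /primitive derivZ derivM derivX deriv_exp derivB derivX derivC.
by rewrite !hornerE /test_function/=; ring.
Qed.

Let deriv_oppE (z : R) : ((- primitive)^`()).[z] = (- test_function z)%R.
Proof. by rewrite derivN hornerN deriv_primitiveE. Qed.

Let deriv_subE (z : R) : (('X - primitive)^`()).[z] = (1 - test_function z)%R.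
Proof. by rewrite derivB derivX hornerD hornerN hornerC deriv_primitiveE. Qed.

Lemma measurable_test_function : measurable_fun setT test_function.
Proof.
rewrite (_ : test_function = horner (primitive^`())); last first.
  by apply/funext => z; rewrite deriv_primitiveE.
apply: continuous_measurable_fun => z.
apply/differentiable_continuous/derivable1_diffP.
by have [] := is_derive_poly (primitive^`()) z.
Qed.

Let h (z : measurableTypeR R) : \bar R := (test_function z)%:E.

Let mhp : measurable_fun setT (h^\+).
Proof. by apply: measurable_funepos; apply/measurable_EFinP; exact: measurable_test_function. Qed.

Let mhn : measurable_fun setT (h^\-).
Proof. by apply: measurable_funeneg; apply/measurable_EFinP; exact: measurable_test_function. Qed.

Let hpE z : (0 <= test_function z)%R -> h^\+ z = (test_function z)%:E.
Proof. by move=> h0; rewrite funeposE max_l// lee_fin. Qed.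

Let hn0 z : (0 <= test_function z)%R -> h^\- z = 0.
Proof. by move=> h0; rewrite funenegE max_r// /h -EFinN lee_fin oppr_le0. Qed.

Let hnE z : (test_function z <= 0)%R -> h^\- z = (- test_function z)%:E.
Proof. by move=> h0; rewrite funenegE max_l// /h -EFinN lee_fin oppr_ge0. Qed.

Hypothesis k0 : (0 < k)%R.

Let test_function_ge0 z :
  (0 <= z)%R -> (m <= z)%R -> (0 <= test_function z)%R.
Proof.
by move=> z0 mz; rewrite /test_function -mulrA pmulr_rge0// mulr_ge0//; lra.
Qed.

(** Positive and negative parts of the test function are kept on separate sides,
    so that no integrability is involved.  The half-line is cut into the block
    [(0, m]], on which the test function has zero Lebesgue integral, the block
    from [m] (or from 0 if [m < 0]) to [c], on which the test function and the
    indicator of [(v, c]] have the same Lebesgue integral, and the remaining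
    half-line, on which the test function is at least 1. *)
Lemma unimodal_right_test_function (v c : R)
    (mu : {measure set (measurableTypeR R) -> \bar R}) : unimodal_right mu ->
  (0 < v)%R -> (m < v)%R -> (v < c)%R ->
  (k * c * (c - m) ^+ 2 = c - v)%R -> (k * (3 * c - m) * (c - m) = 1)%R ->
  mu `[v, +oo[%classic + \int[mu]_(z in `]0%R, +oo[) h^\- z
    <= \int[mu]_(z in `]0%R, +oo[) h^\+ z.
Proof.
move=> uni v0 mv vc tc1 tc2.
pose a := Num.max 0%R m.
have a0 : (0 <= a)%R by rewrite /a le_max lexx.
have av : (a < v)%R by rewrite /a gt_max v0.
have ma : (m <= a)%R by rewrite /a le_max lexx orbT.
rewrite (@ge0_integral_itv_split _ mu (BRight 0%R) (BRight a) +oo%O h^\-)//.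
rewrite (@ge0_integral_itv_split _ mu (BRight 0%R) (BRight a) +oo%O h^\+)//.
rewrite addeCA; apply: leeD.
  have [m0|m0] := leP m 0%R.
    by rewrite /a max_l// set_itvoc0 !integral_set0.
  have am : a = m by rewrite /a max_r// ltW.
  have m30 : (0 < m / 3)%R by rewrite divr_gt0.
  have m3m : (m / 3 < m)%R by lra.
  rewrite am (@ge0_integral_itv_split _ mu _ (BRight (m / 3)%R) _ h^\-)//; last 2 first.
    by rewrite bnd_simp ltW.
    by rewrite bnd_simp ltW.
  rewrite [X in X + _]integral0_eq ?add0e; last first.
    move=> z /=; rewrite in_itv/= => /andP[z0 zm].
    rewrite hn0// /test_function -mulrA pmulr_rge0// mulr_le0//; lra.
  (* The test function changes sign at [m / 3]. *)
  apply: (@le_trans _ _ (\int[mu]_(z in `]0%R, (m / 3)%R[) h^\+ z)).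
    apply: (unimodal_right_transfer uni m30) => //.
      by apply: subset_itvl; rewrite bnd_simp.
    rewrite (eq_integral (fun z : measurableTypeR R => (((- primitive)^`()).[z])%:E)); last first.
      move=> z; rewrite inE/= in_itv/= => /andP[z0 zm].
      rewrite deriv_oppE hnE//.
      by rewrite /test_function -mulrA pmulr_rle0// mulr_ge0_le0//; lra.
    rewrite [leRHS](eq_integral (fun z : measurableTypeR R => (primitive^`().[z])%:E)); last first.
      move=> z; rewrite inE/= in_itv/= => /andP[z0 zm].
      rewrite deriv_primitiveE hpE//.
      by rewrite /test_function -mulrA pmulr_rge0// mulr_le0//; lra.
    rewrite (integral_deriv_poly _ _ _ (ltW m3m)) (integral_deriv_poly _ _ _ (ltW m30)).
    by rewrite !hornerN !primitiveE lee_fin; lra.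
  apply: ge0_subset_integral => //; first exact: measurable_funTS.
  by apply: subset_itv; rewrite bnd_simp// ltW.
rewrite [X in _ + X]integral0_eq ?adde0; last first.
  move=> z /=; rewrite in_itv/= andbT => az.
  by rewrite hn0// test_function_ge0//; lra.
have av' : (BRight a <= BLeft v :> itv_bound R)%O by rewrite bnd_simp.
rewrite (@ge0_integral_itv_split _ mu (BRight a) (BLeft v) +oo%O h^\+)//.
rewrite -(mul1e (mu _)) -integral_cst//.
rewrite (@ge0_integral_itv_split _ mu (BLeft v) (BRight v) +oo%O (cst 1)) ?bnd_simp//.
rewrite [X in X + _]integral_cst// set_itv1 unimodal_right_set1// mule0 add0e.
rewrite (@ge0_integral_itv_split _ mu (BLeft v) (BRight v) +oo%O h^\+) ?bnd_simp//.
rewrite (@ge0_integral_itv_split _ mu (BRight v) (BLeft c) +oo%O h^\+) ?bnd_simp//.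
rewrite (@ge0_integral_itv_split _ mu (BRight v) (BLeft c) +oo%O (cst 1)) ?bnd_simp//.
(* On [(v, c)], 1 is the sum of the test function and of [g], and [g] is
   compensated by the integral of the test function over [(a, v)]. *)
pose g (z : measurableTypeR R) : \bar R := (1 - test_function z)%:E.
have mg : measurable_fun setT g.
  apply/measurable_EFinP; apply: measurable_funB => //.
  exact: measurable_test_function.
have mgp : measurable_fun setT (g^\+) by exact: measurable_funepos.
apply: (@le_trans _ _ (\int[mu]_(z in `]v, c[) g^\+ z +
   (\int[mu]_(z in `]v, c[) h^\+ z + \int[mu]_(z in `[c, +oo[) h^\+ z))).
  rewrite addeA leeD//.
    rewrite -ge0_integralD//; [|exact: measurable_funTS..].
    apply: ge0_le_integral => //.
    - by apply: measurable_funTS; exact: emeasurable_funD.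
    - move=> z _; rewrite /= !funeposE /h /g.
      apply: (@le_trans _ _ ((test_function z)%:E + (1 - test_function z)%:E)).
        by rewrite -EFinD lee_fin; lra.
      by rewrite addeC leeD// le_max lexx.
  apply: ge0_le_integral => //; first exact: measurable_funTS.
  move=> z /=; rewrite in_itv/= andbT => cz.
  rewrite hpE ?test_function_ge0 ?lee_fin//; [|lra..].
  by rewrite -tc2 /test_function -!mulrA ler_pM2l// ler_pM//; lra.
apply: leeD; last by rewrite leeDr// integral_ge0.
apply: (@le_trans _ _ (\int[mu]_(z in `]a, v[) h^\+ z)) => //.
apply: (unimodal_right_transfer uni v0) => //.
- by apply: subset_itv; rewrite bnd_simp.
- by apply: subset_itv; rewrite bnd_simp.
rewrite (eq_integral (fun z : measurableTypeR R => ((('X - primitive)^`()).[z])%:E)); last first.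
  move=> z; rewrite inE/= in_itv/= => /andP[vz zc].
  rewrite deriv_subE.
  rewrite funeposE max_l// /g lee_fin subr_ge0.
  by rewrite -tc2 /test_function -!mulrA ler_pM2l// ler_pM//; lra.
rewrite [leRHS](eq_integral (fun z : measurableTypeR R => (primitive^`().[z])%:E)); last first.
  move=> z; rewrite inE/= in_itv/= => /andP[az zv].
  by rewrite deriv_primitiveE hpE// test_function_ge0//; lra.
rewrite (integral_deriv_poly _ _ _ (ltW vc)) (integral_deriv_poly _ _ _ (ltW av)).
rewrite !(hornerD, hornerN, hornerX) !primitiveE lee_fin.
have -> : (k * a * (a - m) ^+ 2 = 0)%R.
  by rewrite /a; have [m0|m0] := leP m 0%R; ring.
by rewrite tc1; lra.
Qed.
End half_line.

(** * Unimodal laws *)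

Section supporting_slope.
Context {R : realType}.
Implicit Types (f : R -> R) (D : set R).

(** Concavity as monotonicity of the slopes of consecutive chords, cleared of
    denominators. *)
Definition chord_concave D f := forall x y z, D x -> D y -> D z ->
  x < y -> y < z -> (f z - f y) * (y - x) <= (f y - f x) * (z - y).

Lemma convex_function_chord D f : @convex_function R R^o D f ->
  chord_concave D (fun x => - f x).
Proof.
move=> cf x y z Dx Dy Dz xy yz.
have xz : x < z by exact: lt_trans yz.
have zx0 : 0 < z - x by rewrite subr_gt0.
have t01 : 0 <= (z - y) / (z - x) <= 1.
  by apply/andP; split; [rewrite divr_ge0//; lra|rewrite ler_pdivrMr//; lra].
case/andP: t01 => t0 t1.
have := cf (Itv01 t0 t1) x z; rewrite !inE => /(_ Dx Dz).
rewrite !convRE/= /unstable.onem.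
rewrite [X in f X](_ : _ = y); last first.
  transitivity ((z - y) / (z - x) * x + (1 - (z - y) / (z - x)) * z); first by [].
  by field; lra.
rewrite -(ler_pM2l zx0) => h.
suff : (z - x) * f y <= (z - y) * f x + (y - x) * f z by lra.
by rewrite (le_trans h)// le_eqVlt; apply/orP; left; apply/eqP; field; lra.
Qed.

(** The slope is the supremum of the slopes of the chords starting at [b] to the
    right; the points [a] and [c] make this supremum finite and nonnegative. *)
Lemma supporting_slope D f (a b c : R) : chord_concave D f ->
  {in D &, {homo f : x y / x <= y}} ->
  D a -> D b -> D c -> a < b -> b < c ->
  exists s : {nonneg R},
    (forall x y, D x -> D y -> x < y -> y <= b -> s%:num * (y - x) <= f y - f x) /\
    (forall x y, D x -> D y -> b <= x -> x < y -> f y - f x <= s%:num * (y - x)).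
Proof.
move=> cf ndf Da Db Dc ab bc.
pose S := [set (f z - f b) / (z - b) | z in [set z | D z /\ b < z]].
have Sub x y : D x -> D y -> x < y -> y <= b -> ubound S ((f y - f x) / (y - x)).
  move=> Dx Dy xy yb _ [z [Dz bz] <-].
  have xb : x < b by exact: lt_le_trans yb.
  apply: (@le_trans _ _ ((f b - f x) / (b - x))).
    rewrite ler_pdivrMr ?subr_gt0// mulrAC ler_pdivlMr ?subr_gt0//.
    exact: cf.
  move: yb; rewrite le_eqVlt => /predU1P[->//|yb].
  rewrite ler_pdivrMr ?subr_gt0// mulrAC ler_pdivlMr ?subr_gt0//.
  by have := cf x y b Dx Dy Db xy yb; lra.
have S0 : has_sup S.
  split; first by exists ((f c - f b) / (c - b)); exists c.
  by exists ((f b - f a) / (b - a)); apply: Sub.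
have Sle x : D x -> b < x -> (f x - f b) / (x - b) <= sup S.
  by move=> Dx bx; apply: ub_le_sup; [case: S0|exists x].
have s0 : 0 <= sup S.
  apply: le_trans (Sle _ Dc bc).
  by rewrite divr_ge0// subr_ge0; [apply: ndf; rewrite ?inE//|]; exact: ltW.
exists (NngNum s0); split => x y Dx Dy /= h1 h2.
  rewrite -ler_pdivlMr ?subr_gt0//; apply: ge_sup; first by case: S0.
  exact: Sub.
rewrite -ler_pdivrMr ?subr_gt0//.
move: h1; rewrite le_eqVlt => /predU1P[bx|bx].
  by subst x; exact: Sle.
apply: le_trans (Sle _ Dx bx).
rewrite ler_pdivrMr ?subr_gt0// mulrAC ler_pdivlMr ?subr_gt0//.
exact: cf.
Qed.

End supporting_slope.

Section itv_setI.
Context {R : realType}.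
Implicit Types x y a b : R.

Lemma itv_oc_setI x y a b : `]x, y]%classic `&` `]a, b]%classic =
  `]Num.max x a, Num.min y b]%classic.
Proof.
apply/seteqP; split=> z /=; rewrite !in_itv/= gt_max le_min.
  by move=> [/andP[-> ->] /andP[-> ->]].
by move=> /andP[/andP[-> ->] /andP[-> ->]].
Qed.

Lemma itv_oc_setIy x y b : `]x, y]%classic `&` `]b, +oo[%classic =
  `]Num.max x b, y]%classic.
Proof.
apply/seteqP; split=> z /=; rewrite !in_itv/= andbT gt_max.
  by move=> [/andP[-> ->] ->].
by move=> /andP[/andP[-> ->] ->].
Qed.

Lemma itv_oc_setINy x y b : `]x, y]%classic `&` `]-oo, b]%classic =
  `]x, Num.min y b]%classic.
Proof.
apply/seteqP; split=> z /=; rewrite !in_itv/= le_min.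
  by move=> [/andP[-> ->] ->].
by move=> /andP[-> /andP[-> ->]].
Qed.

End itv_setI.

Section interval_comparison.
Context {R : realType}.
Local Open Scope ereal_scope.
Variable mu : probability (measurableTypeR R) R.
Variable s : {nonneg R}.

Lemma lebesgue_le_of_intervals (a b : R) :
  (forall x y, (a <= x)%R -> (x < y)%R -> (y <= b)%R ->
     (s%:num * (y - x))%:E <= mu `]x, y]%classic) ->
  forall A : set (measurableTypeR R), measurable A -> A `<=` `]a, b] ->
    s%:num%:E * lebesgue_measure A <= mu A.
Proof.
move=> H A mA Aab; apply: (@mscale_lebesgue_le _ mu s `]a, b]%classic) => //.
move=> x y xy; rewrite itv_oc_setI.
have [h|h] := ltP (Num.max x a) (Num.min y b); last first.
  rewrite set_itv_ge; last by rewrite bnd_simp -leNgt.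
  by rewrite measure0 mule0.
rewrite lebesgue_measure_itv/= lte_fin h -EFinD -EFinM.
apply: (le_trans (H _ _ _ h _)); rewrite ?le_max ?ge_min ?lexx ?orbT//.
apply: le_measure; rewrite ?inE//.
by apply: subset_itv; rewrite bnd_simp ?le_max ?ge_min lexx.
Qed.

Lemma le_lebesgue_of_intervals_right (b : R) :
  (forall x y, (b <= x)%R -> (x < y)%R ->
     mu `]x, y]%classic <= (s%:num * (y - x))%:E) ->
  forall A : set (measurableTypeR R), measurable A -> A `<=` `]b, +oo[ ->
    mu A <= s%:num%:E * lebesgue_measure A.
Proof.
move=> H A mA Aab; apply: (@le_mscale_lebesgue _ s mu `]b, +oo[%classic) => //.
move=> x y xy; rewrite itv_oc_setIy.
have [h|h] := ltP (Num.max x b) y; last first.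
  rewrite set_itv_ge; last by rewrite bnd_simp -leNgt.
  by rewrite measure0 lee_fin mulr_ge0// subr_ge0 ltW.
apply: (le_trans (H _ _ _ h)); rewrite ?le_max ?lexx ?orbT//.
by rewrite lee_fin ler_wpM2l// lerB// le_max lexx.
Qed.

Lemma le_lebesgue_of_intervals_left (b : R) :
  (forall x y, (x < y)%R -> (y <= b)%R ->
     mu `]x, y]%classic <= (s%:num * (y - x))%:E) ->
  forall A : set (measurableTypeR R), measurable A -> A `<=` `]-oo, b] ->
    mu A <= s%:num%:E * lebesgue_measure A.
Proof.
move=> H A mA Aab; apply: (@le_mscale_lebesgue _ s mu `]-oo, b]%classic) => //.
move=> x y xy; rewrite itv_oc_setINy.
have [h|h] := ltP x (Num.min y b); last first.
  rewrite set_itv_ge; last by rewrite bnd_simp -leNgt.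
  by rewrite measure0 lee_fin mulr_ge0// subr_ge0 ltW.
apply: (le_trans (H _ _ h _)); rewrite ?ge_min ?lexx ?orbT//.
by rewrite lee_fin ler_wpM2l// lerB// ge_min lexx.
Qed.

End interval_comparison.

Section unimodal_laws.
Context d (T : measurableType d) (R : realType) (P : probability T R).
Local Open Scope ereal_scope.
Variable Z : {RV P >-> R}.

(* Two laws on the Borel structure that carries the Lebesgue measure. *)
Let Zp : T -> measurableTypeR R := Z.
Let Zn : T -> measurableTypeR R := fun w => (- Z w)%R.

Let mZp : measurable_fun setT Zp.
Proof. by move=> mT A mA; exact: (@measurable_funP _ _ _ _ setT Z mT A mA). Qed.

Let mZn : measurable_fun setT Zn.
Proof.
by move=> mT A mA; apply: (measurable_funN _ mT).
Qed.

HB.instance Definition _ := isMeasurableFun.Build _ _ _ _ Zp mZp.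
HB.instance Definition _ := isMeasurableFun.Build _ _ _ _ Zn mZn.

Definition law : probability (measurableTypeR R) R := distribution P Zp.
Definition law_opp : probability (measurableTypeR R) R := distribution P Zn.

Lemma ge0_integral_law (D : set (measurableTypeR R))
    (f : measurableTypeR R -> \bar R) :
  measurable D -> measurable_fun setT f -> (forall z, 0 <= f z) ->
  \int[law]_(z in D) f z = \int[P]_(w in Z @^-1` D) f (Z w).
Proof.
by move=> mD mf f0; apply: ge0_integral_pushforward => //; exact: measurable_funTS.
Qed.

Lemma ge0_integral_law_opp (D : set (measurableTypeR R))
    (f : measurableTypeR R -> \bar R) :
  measurable D -> measurable_fun setT f -> (forall z, 0 <= f z) ->
  \int[law_opp]_(z in D) f z =
  \int[P]_(w in (fun w => - Z w)%R @^-1` D) f (- Z w)%R.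
Proof.
by move=> mD mf f0; apply: ge0_integral_pushforward => //; exact: measurable_funTS.
Qed.

Let F (x : R) := fine (cdf Z x).

Let lawE (x y : R) : (x < y)%R -> law `]x, y]%classic = (F y - F x)%:E.
Proof.
move=> xy; rewrite EFinB !fineK ?fin_num_measure//.
have -> : cdf Z y = cdf Z x + law `]x, y]%classic.
  rewrite /cdf /law /distribution /pushforward/= -measureU//.
  - rewrite -preimage_setU -itv_bndbnd_setU//.
    by rewrite bnd_simp ltW.
  - exact: measurable_funPTI.
  - exact: measurable_funPTI.
  - rewrite -preimage_setI setIC itv_oc_setINy min_r ?ltW//.
    by rewrite set_itvoc0 preimage_set0.
by rewrite addeAC subee ?add0e// fin_num_measure.
Qed.

Let F_nondecreasing : {homo F : x y / (x <= y)%R}.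
Proof.
by move=> x y xy; rewrite fine_le ?fin_num_measure// cdf_nondecreasing.
Qed.

Lemma unimodal_right_law : unimodal Z 0 -> unimodal_right law.
Proof.
move=> [_ /convex_function_chord ccF] b b0.
have [] := @supporting_slope R `[0%R, +oo[%classic F 0%R b (b + 1)%R.
- move=> x y z Dx Dy Dz xy yz.
  by have := ccF x y z Dx Dy Dz xy yz; rewrite !opprK.
- by move=> x y _ _; exact: F_nondecreasing.
- by rewrite /= in_itv/= lexx.
- by rewrite /= in_itv/= ltW.
- by rewrite /= in_itv/= andbT ltW// (lt_trans b0)// ltrDl.
- by [].
- by rewrite ltrDl.
move=> s [low up]; exists s; split=> A mA AD.
  apply: (@lebesgue_le_of_intervals _ law s 0%R b) => //.
    move=> x y x0 xy yb; rewrite lawE// lee_fin low//= ?in_itv/= ?andbT//.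
    by rewrite (le_trans x0)// ltW.
  by apply: (subset_trans AD); apply: subset_itvl; rewrite bnd_simp.
apply: (@le_lebesgue_of_intervals_right _ law s b) => //.
move=> x y bx xy; have x0 : (0 <= x)%R by rewrite (le_trans _ bx)// ltW.
rewrite lawE// lee_fin up//= ?in_itv/= ?andbT//.
by rewrite (le_trans x0)// ltW.
Qed.

Let law_oppE (A : set (measurableTypeR R)) :
  (law_opp : {measure set (measurableTypeR R) -> \bar R}) A = law (-%R @^-1` A).
Proof. by []. Qed.

(** On [(0, oo)] the function [x |-> - F (- x)] is concave and nondecreasing;
    its supporting slope at [b] is used for [F] at [- b]. *)
Lemma unimodal_right_law_opp : unimodal Z 0 -> unimodal_right law_opp.
Proof.
move=> [/convex_function_chord ccF _] b b0.
have [] := @supporting_slope R `]0%R, +oo[%classic (fun x => - F (- x))%R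
  (b / 2)%R b (b + 1)%R.
- move=> x y z /=; rewrite !in_itv/= !andbT => x0 y0 z0 xy yz.
  have := ccF (- z)%R (- y)%R (- x)%R; rewrite /= !in_itv/= !oppr_lt0 !ltrN2.
  by move=> /(_ z0 y0 x0 yz xy); rewrite /F; lra.
- by move=> x y _ _ xy; rewrite lerN2 F_nondecreasing// lerN2.
- by rewrite /= in_itv/= andbT divr_gt0.
- by rewrite /= in_itv/= andbT.
- by rewrite /= in_itv/= andbT (lt_trans b0)// ltrDl.
- by rewrite ltr_pdivrMr// ltr_pMr// ltr1n.
- by rewrite ltrDl.
move=> s [low up].
have lowF x y : (- b <= x)%R -> (x < y)%R -> (y < 0)%R ->
    (s%:num * (y - x) <= F y - F x)%R.
  move=> bx xy y0; have := low (- y)%R (- x)%R.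
  rewrite /= !in_itv/= !andbT !oppr_gt0 ltrN2 lerNl !opprK.
  by move=> /(_ y0 (lt_trans xy y0) xy bx); lra.
exists s; split=> A mA AD; rewrite law_oppE -lebesgue_measureN//.
  apply: (@lebesgue_le_of_intervals _ law s (- b)%R 0%R).
  - move=> x y bx xy; rewrite le_eqVlt => /predU1P[y0|y0]; last first.
      by rewrite lawE// lee_fin; exact: lowF.
    (* At the mode [F] may jump, so the interval that ends there is reached as a
       limit of intervals [(x, y]] with [y < 0], using only [F y <= F 0]. *)
    subst y; rewrite lawE// lee_fin sub0r.
    have x0 : (x < 0)%R by [].
    rewrite leNgt; apply/negP => h.
    have s0 : (0 < s%:num)%R.
      rewrite lt_neqAle ge0 andbT; apply/negP => /eqP s0.
      move: h; rewrite -s0 mul0r subr_lt0.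
      by rewrite ltNge F_nondecreasing// ltW.
    pose e := ((s%:num * - x - (F 0 - F x)) / (2 * s%:num))%R.
    have e0 : (0 < e)%R by rewrite divr_gt0 ?subr_gt0// mulr_gt0.
    pose y := Num.max (- e)%R (x / 2)%R.
    have y0 : (y < 0)%R by rewrite /y gt_max oppr_lt0 e0; lra.
    have xy' : (x < y)%R by rewrite /y lt_max; apply/orP; right; lra.
    have ey : (- e <= y)%R by rewrite /y le_max lexx.
    have := lowF x y bx xy' y0.
    have : (F y <= F 0)%R by apply: F_nondecreasing; exact: ltW.
    have : (s%:num * - e <= s%:num * y)%R by rewrite ler_pM2l.
    have : (s%:num * - e = - (s%:num * - x - (F 0 - F x)) / 2)%R.
      by rewrite /e; field; rewrite gt_eqF.
    lra.
  - by rewrite -[X in measurable X]setTI; exact: oppr_measurable.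
  - by move=> x /= /AD /=; rewrite !in_itv/=; lra.
apply: (@le_lebesgue_of_intervals_left _ law s (- b)%R).
- move=> x y xy yb; have := up (- y)%R (- x)%R.
  rewrite lawE// lee_fin /= !in_itv/= !andbT !oppr_gt0 ltrN2 lerNr.
  have y0 : (y < 0)%R by lra.
  by move=> /(_ y0 (lt_trans xy y0) yb xy); rewrite !opprK; lra.
- by rewrite -[X in measurable X]setTI; exact: oppr_measurable.
- by move=> x /= /AD /=; rewrite !in_itv/= andbT; lra.
Qed.
End unimodal_laws.

(** * The tail bound *)

Section moments.
Context d (T : measurableType d) (R : realType) (P : probability T R).
Local Open Scope ereal_scope.
Variable Z : {RV P >-> R}.

Lemma variance_centered : 'E_P[Z] = 0 ->
  'V_P[Z] = \int[P]_w ((Z w ^+ 2)%R)%:E.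
Proof.
move=> Z0; rewrite /variance covariance.unlock Z0 expectation.unlock.
apply: eq_integral => w _.
by rewrite [LHS](_ : _ = ((Z w - 0) * (Z w - 0))%:E)// subr0 expr2.
Qed.

Hypotheses (Z0 : 'E_P[Z] = 0) (Z1 : 'V_P[Z] = 1).

Let mZ : measurable_fun setT Z. Proof. exact: measurable_funP. Qed.

Let int_sqr : P.-integrable setT (fun w => ((Z w ^+ 2)%R)%:E).
Proof.
apply/integrableP; split.
  by apply/measurable_EFinP; exact: measurable_funX.
rewrite (eq_integral (fun w => ((Z w ^+ 2)%R)%:E)).
  by rewrite -variance_centered// Z1 ltry.
by move=> w _; rewrite gee0_abs// lee_fin sqr_ge0.
Qed.

Let int_id : P.-integrable setT (fun w => (Z w)%:E).
Proof.
apply: (@le_integrable _ _ _ _ _ _ _ (fun w => (1 + Z w ^+ 2)%:E)) => //.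
- exact/measurable_EFinP.
- move=> w _ /=; rewrite lee_fin [leRHS]ger0_norm; last by rewrite addr_ge0// sqr_ge0.
  have : (0 <= (`|Z w| - 1) ^+ 2)%R by exact: sqr_ge0.
  rewrite sqrrB1 real_normK ?num_real//; have := normr_ge0 (Z w); lra.
- under [X in _.-integrable _ X]eq_fun do rewrite EFinD.
  apply: integrableD => //; exact: finite_measure_integrable_cst.
Qed.

(** The test function is a combination of [Z^2], [Z] and 1, whose means are
    1, 0 and 1. *)
Lemma integral_test_function k m :
  \int[P]_w (test_function k m (Z w))%:E = (k * (3 + m ^+ 2))%:E /\
  P.-integrable setT (fun w => (test_function k m (Z w))%:E).
Proof.
have E w : (test_function k m (Z w))%:E = (3 * k)%:E * (Z w ^+ 2)%:E +
   ((- 4 * k * m)%:E * (Z w)%:E + (k * m ^+ 2)%:E).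
  by rewrite -!EFinM -!EFinD /test_function; congr (_%:E); ring.
have i1 : P.-integrable setT (fun w => (3 * k)%:E * (Z w ^+ 2)%:E).
  exact: integrableZl.
have i2 : P.-integrable setT (fun w => (- 4 * k * m)%:E * (Z w)%:E).
  exact: integrableZl.
have i3 : P.-integrable setT (fun w => (k * m ^+ 2)%:E).
  exact: finite_measure_integrable_cst.
have i4 : P.-integrable setT
    (fun w => (- 4 * k * m)%:E * (Z w)%:E + (k * m ^+ 2)%:E).
  exact: integrableD.
split; last first.
  under [X in _.-integrable _ X]eq_fun do rewrite E.
  exact: integrableD.
under eq_integral do rewrite E.
rewrite integralD// integralD// !integralZl// integral_cst//= probability_setT.
rewrite -variance_centered// Z1.
have -> : \int[P]_w (Z w)%:E = 0 by rewrite -Z0 expectation.unlock.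
by rewrite mule0 add0e !mule1 -EFinD; congr (_%:E); ring.
Qed.

End moments.

Section tail_bound.
Context d (T : measurableType d) (R : realType) (P : probability T R).
Local Open Scope ereal_scope.
Variable Z : {RV P >-> R}.

(** The half-line estimate is applied to the laws of [Z] and of [- Z]; the
    remaining point 0 only contributes the nonnegative value [k m^2]. *)
Lemma unimodal_tail_bound (k m u v b c : R) :
  'E_P[Z] = 0 -> 'V_P[Z] = 1 -> unimodal Z 0 ->
  (0 < k)%R -> (0 < u)%R -> (0 < v)%R ->
  [/\ m < v, v < c, k * c * (c - m) ^+ 2 = c - v &
      k * (3 * c - m) * (c - m) = 1]%R ->
  [/\ - m < u, u < b, k * b * (b - - m) ^+ 2 = b - u &
      k * (3 * b - - m) * (b - - m) = 1]%R ->
  P [set w | (Z w <= - u \/ v <= Z w)%R] <= (k * (3 + m ^+ 2))%:E.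
Proof.
move=> Z0 Z1 uni k0 u0 v0 [mv vc c1 c2] [mu ub b1 b2].
have mZ : measurable_fun setT Z by exact: measurable_funP.
pose h w := (test_function k m (Z w))%:E.
have [Eh ih] := integral_test_function Z0 Z1 k m.
have mh : measurable_fun setT h by case/integrableP : ih.
have mhp : measurable_fun setT h^\+ by exact: measurable_funepos.
have mhn : measurable_fun setT h^\- by exact: measurable_funeneg.
pose Tp := Z @^-1` `]0%R, +oo[; pose Tn := Z @^-1` `]-oo, 0%R[; pose T0 := Z @^-1` [set 0%R].
have mTp : measurable Tp by exact: measurable_funPTI.
have mTn : measurable Tn by exact: measurable_funPTI.
have mT0 : measurable T0 by exact: measurable_funPTI.
have mtf q : measurable_fun setT (fun z : measurableTypeR R => (test_function k q z)%:E).
  by apply/measurable_EFinP; exact: measurable_test_function.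
have right : P [set w | (v <= Z w)%R] + \int[P]_(w in Tp) h^\- w <=
    \int[P]_(w in Tp) h^\+ w.
  have := unimodal_right_test_function k0 (unimodal_right_law uni) v0 mv vc c1 c2.
  rewrite !ge0_integral_law//; [|exact: measurable_funepos|exact: measurable_funeneg].
  rewrite (eq_integral h^\-); last by move=> w _; rewrite !funenegE.
  rewrite [X in _ <= X -> _](eq_integral h^\+); last by move=> w _; rewrite !funeposE.
  apply: le_trans; rewrite leeD2r// le_eqVlt; apply/orP; left; apply/eqP.
  congr (P _); apply/seteqP; split => w /=; by rewrite in_itv/= andbT.
have left : P [set w | (Z w <= - u)%R] + \int[P]_(w in Tn) h^\- w <=
    \int[P]_(w in Tn) h^\+ w.
  have := unimodal_right_test_function k0 (unimodal_right_law_opp uni) u0 mu ub b1 b2.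
  rewrite !ge0_integral_law_opp//; [|exact: measurable_funepos|exact: measurable_funeneg].
  have hN w : test_function k (- m) (- Z w) = test_function k m (Z w).
    by rewrite /test_function; ring.
  have -> : (fun w => - Z w)%R @^-1` `]0%R, +oo[ = Tn.
    by apply/seteqP; split => w; rewrite /= !in_itv/= andbT oppr_gt0.
  rewrite (eq_integral h^\-); last by move=> w _; rewrite !funenegE/= hN.
  rewrite [X in _ <= X -> _](eq_integral h^\+); last by move=> w _; rewrite !funeposE/= hN.
  apply: le_trans; rewrite leeD2r// le_eqVlt; apply/orP; left; apply/eqP.
  congr (P _); apply/seteqP; split => w /=; by rewrite in_itv/= andbT lerNr.
have split (f : T -> \bar R) : measurable_fun setT f -> (forall w, 0 <= f w) ->
    \int[P]_w f w = \int[P]_(w in Tp) f w + \int[P]_(w in Tn) f w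
                    + \int[P]_(w in T0) f w.
  move=> mf f0; have E : setT = (Tp `|` Tn) `|` T0.
    rewrite /Tp /Tn /T0 -!preimage_setU -[LHS](preimage_setT Z); congr (Z @^-1` _).
    apply/seteqP; split => z //= _; rewrite !in_itv/= andbT.
    by case: (ltgtP z 0%R) => [z0|z0|->]; [left; right|left; left|right].
  rewrite [in LHS]E ge0_integral_setU//; last 3 first.
  - exact: measurableU.
  - by apply: measurable_funTS.
  - rewrite disj_set2E; apply/eqP; rewrite -subset0 => w [[]];
    by rewrite /Tp /Tn /T0 /= in_itv/= ?andbT => + w0; rewrite w0 ltxx.
  rewrite ge0_integral_setU//.
  - by apply: measurable_funTS.
  - rewrite disj_set2E; apply/eqP; rewrite -subset0 => w [].
    by rewrite /Tp /Tn /= !in_itv/= andbT; lra.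
have T00 : \int[P]_(w in T0) h^\- w = 0.
  apply: integral0_eq => w /= Zw; rewrite funenegE max_r// /h Zw -EFinN lee_fin.
  by rewrite oppr_le0 /test_function mulr0 !sub0r -mulrA mulrNN pmulr_rge0// -expr2 sqr_ge0.
have main : P [set w | (Z w <= - u \/ v <= Z w)%R] + \int[P]_w h^\- w <=
    \int[P]_w h^\+ w.
  rewrite (split _ mhn)// (split _ mhp)// T00 adde0.
  rewrite (_ : [set w | _] =
      [set w | (v <= Z w)%R] `|` [set w | (Z w <= - u)%R]); last first.
    by apply/seteqP; split => w /= []; [right|left|right|left].
  rewrite measureU//; last 3 first.
  - rewrite (_ : [set w | _] = Z @^-1` `[v, +oo[); first exact: measurable_funPTI.
    by apply/seteqP; split => w /=; rewrite in_itv/= andbT.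
  - rewrite (_ : [set w | _] = Z @^-1` `]-oo, (- u)%R]); first exact: measurable_funPTI.
    by apply/seteqP; split => w /=; rewrite in_itv/=.
  - by rewrite -subset0 => w [] /=; lra.
  rewrite addeACA; apply: le_trans (leeD right left) _.
  by rewrite leeDl// integral_ge0.
rewrite -Eh integralE leeBrDr//.
by apply: integrable_neg_fin_num.
Qed.
End tail_bound.

(** * Mixtures of scaled uniform laws *)

Section uniform_scaling.
Context {R : realType}.
Local Open Scope ereal_scope.

Local Notation unif := (uniform_prob (@ltr01 R)).

Lemma uniform01_lebesgue (A : set (measurableTypeR R)) : measurable A ->
  unif A = lebesgue_measure (A `&` `[0%R, 1%R]).
Proof.
move=> mA; rewrite /uniform_prob integral_uniform_pdf.
rewrite (eq_integral (cst 1)); last first.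
  by move=> x; rewrite inE/= in_itv/= /uniform_pdf subr0 invr1 => -[_ ->].
rewrite (@integral_cst _ _ _ (@lebesgue_measure R)) ?mul1e//.
exact: measurableI.
Qed.

Definition scaled (y : R) : measurableTypeR R -> measurableTypeR R :=
  fun t => (t * y)%R.

Lemma measurable_scaled y : measurable_fun setT (scaled y).
Proof. by move=> mT A mA; exact: (@mulrr_measurable R setT y mT A mA). Qed.

HB.instance Definition _ y :=
  isMeasurableFun.Build _ _ _ _ (scaled y) (measurable_scaled y).

Let measurable_scaled_preimage y (A : set R) :
  measurable (A : set (measurableTypeR R)) -> measurable (scaled y @^-1` A).
Proof.
by move=> mA; rewrite -[X in measurable X]setTI; exact: measurable_scaled.
Qed.

Let measurable_tail (u v : R) :
  measurable ([set z | (z <= - u \/ v <= z)%R] : set (measurableTypeR R)).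
Proof.
rewrite (_ : mkset _ = `]-oo, (- u)%R] `|` `[v, +oo[); first exact: measurableU.
by apply/seteqP; split => z /=; rewrite !in_itv/= andbT.
Qed.

Let uniform01_scaled_itv y (A : set R) (i : interval R) :
  measurable (A : set (measurableTypeR R)) ->
  (forall t, (0 <= t <= 1)%R -> A (t * y)%R <-> t \in i) ->
  [set` i] `<=` `[0%R, 1%R] ->
  unif (scaled y @^-1` A) = lebesgue_measure [set` i].
Proof.
move=> mA Ai i01; rewrite uniform01_lebesgue; last exact: measurable_scaled_preimage.
congr lebesgue_measure; apply/seteqP; split => [t [/= ty]|t ti].
  by rewrite in_itv/= => t01; apply/(Ai _ t01).
have t01 := i01 _ ti; split => //=; move: t01; rewrite /= in_itv/= => t01.
exact/(Ai _ t01).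
Qed.

Lemma uniform01_scaled_left_tail (u v y : R) :
  (0 < u)%R -> (0 < v)%R -> (y < - u)%R ->
  unif (scaled y @^-1` [set z | (z <= - u \/ v <= z)%R]) = (1 - u / - y)%:E.
Proof.
move=> u0 v0 yu; have y0 : (0 < - y)%R by lra.
have r0 : (0 < u / - y)%R by exact: divr_gt0.
have r1 : (u / - y < 1)%R by rewrite ltr_pdivrMr//; lra.
rewrite (@uniform01_scaled_itv _ _ `[u / - y, 1]%R)//.
- by rewrite lebesgue_measure_itv/= lte_fin r1.
- move=> t /andP[t0 t1]; rewrite in_itv/= t1 andbT ler_pdivrMr//=.
  by split => [[|]|]; [lra|nra|left; lra].
- by apply: subset_itv; rewrite bnd_simp// ltW.
Qed.

Lemma uniform01_scaled_right_tail (u v y : R) :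
  (0 < u)%R -> (0 < v)%R -> (v < y)%R ->
  unif (scaled y @^-1` [set z | (z <= - u \/ v <= z)%R]) = (1 - v / y)%:E.
Proof.
move=> u0 v0 vy; have y0 : (0 < y)%R by lra.
have r0 : (0 < v / y)%R by exact: divr_gt0.
have r1 : (v / y < 1)%R by rewrite ltr_pdivrMr//; lra.
rewrite (@uniform01_scaled_itv _ _ `[v / y, 1]%R)//.
- by rewrite lebesgue_measure_itv/= lte_fin r1.
- move=> t /andP[t0 t1]; rewrite in_itv/= t1 andbT ler_pdivrMr//=.
  by split => [[|]|]; [nra|lra|right; lra].
- by apply: subset_itv; rewrite bnd_simp// ltW.
Qed.

Lemma uniform01_scaled_no_tail (u v y : R) : (- u < y)%R -> (y < v)%R ->
  (0 < u)%R -> (0 < v)%R ->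
  unif (scaled y @^-1` [set z | (z <= - u \/ v <= z)%R]) = 0.
Proof.
move=> uy yv u0 v0.
rewrite (@uniform01_scaled_itv _ _ `]1, 0]%R)//.
- by rewrite lebesgue_measure_itv/= lte_fin ltr10.
- move=> t /andP[t0 t1]; rewrite in_itv/=.
  have pos (a b : R) : (0 < a -> 0 < b -> 0 < t * a + (1 - t) * b)%R.
    move=> a0 b0; have [t00|t00] := ltP 0%R t.
      by rewrite ltr_wpDr ?mulr_gt0// mulr_ge0; lra.
    by have -> : t = 0%R by [lra|]; rewrite mul0r add0r subr0 mul1r.
  have uy0 : (0 < u + y)%R by lra.
  have vy0 : (0 < v - y)%R by lra.
  have := pos _ _ uy0 u0; have := pos _ _ vy0 v0.
  by split => [[|]|/andP[]]; lra.
- by move=> t /=; rewrite !in_itv/=; lra.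
Qed.

(** The distribution function is written as a maximum of affine functions on
    [x < 0], and as the opposite of such a maximum on [0 <= x], with the same
    constant for all [y]; this makes its convexity properties, and those of
    mixtures, visible. *)
Lemma uniform01_scaled_cdf_neg (y x : R) : (x < 0)%R ->
  unif (scaled y @^-1` `]-oo, x]) =
  (Num.max 0 ((if (y < 0)%R then - y^-1 else 0) * x
              + (if (y < 0)%R then 1 else 0)))%:E.
Proof.
move=> x0; have [y0|y0] := ltP y 0%R; last first.
  rewrite mul0r addr0 maxxx (@uniform01_scaled_itv _ _ `]1, 0]%R)//.
  - by rewrite lebesgue_measure_itv/= lte_fin ltr10.
  - by move=> t /andP[t0 t1]; rewrite /= !in_itv/=; split => [|/andP[]]; nra.
  - by move=> t /=; rewrite !in_itv/=; lra.
have ry : (- y^-1 * x = - (x / y))%R by ring.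
have r0 : (0 < x / y)%R by rewrite -mulrNN -invrN divr_gt0// oppr_gt0.
rewrite (@uniform01_scaled_itv _ _ `[x / y, 1]%R)//.
- rewrite lebesgue_measure_itv/= lte_fin ry.
  have [h|h] := ltP (x / y)%R 1%R; rewrite -?EFinD.
    by rewrite max_r; [congr (_%:E); ring|lra].
  by rewrite max_l; [|lra].
- by move=> t /andP[t0 t1]; rewrite /= !in_itv/= t1 andbT ler_ndivrMr.
- by apply: subset_itv; rewrite bnd_simp// ltW.
Qed.

Lemma uniform01_scaled_cdf_ge0 (y x : R) : (0 <= x)%R ->
  unif (scaled y @^-1` `]-oo, x]) =
  (- Num.max (- 1) ((if (0 < y)%R then - y^-1 else 0) * x
                    + (if (0 < y)%R then 0 else - 1)))%:E.
Proof.
move=> x0; have [y0|y0] := ltP 0%R y; last first.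
  rewrite mul0r add0r maxxx opprK (@uniform01_scaled_itv _ _ `[0, 1]%R)//.
  - by rewrite lebesgue_measure_itv/= lte_fin ltr01 -EFinD subr0.
  - by move=> t /andP[t0 t1]; rewrite /= !in_itv/= t0 t1; split => // _; nra.
have ry : (- y^-1 * x = - (x / y))%R by ring.
have r0 : (0 <= x / y)%R by rewrite divr_ge0// ltW.
rewrite (@uniform01_scaled_itv _ _ `[0, Num.min 1 (x / y)]%R)//.
- rewrite lebesgue_measure_itv/= lte_fin ry -EFinD subr0 addr0.
  have [h|h] := leP 1%R (x / y)%R.
    by rewrite ltr01 max_l ?opprK//; lra.
  rewrite max_r ?opprK; last by lra.
  by case: ltP => // r0'; congr (_%:E); lra.
- by move=> t /andP[t0 t1]; rewrite /= !in_itv/= t0 le_min t1 /= ler_pdivlMr.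
- by apply: subset_itv; rewrite bnd_simp// ge_min lexx.
Qed.

Let integral_uniform01 (f : measurableTypeR R -> \bar R) :
  measurable_fun setT f -> (forall x, 0 <= f x) ->
  \int[unif]_t f t = \int[lebesgue_measure]_(t in `[0%R, 1%R]) f t.
Proof.
by move=> mf f0; rewrite integral_uniform// subr0 invr1 mul1e.
Qed.

Let integral01_id (a : R) :
  \int[lebesgue_measure]_(t in `[0%R, 1%R]) ((t * a)%R)%:E = (a / 2)%:E.
Proof.
rewrite (eq_integral (fun t : measurableTypeR R =>
  (((a / 2) *: 'X^2 : {poly R})^`().[t])%:E)); last first.
  move=> t _; rewrite derivZ derivXn hornerZ hornerMn hornerX; congr (_%:E).
  by rewrite -mulr_natr; field.
rewrite integral_deriv_poly ?ler01// !hornerZ !hornerXn expr1n expr0n/=.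
by congr (_%:E); ring.
Qed.

Let integral01_sqr (a : R) :
  \int[lebesgue_measure]_(t in `[0%R, 1%R]) ((t ^+ 2 * a)%R)%:E = (a / 3)%:E.
Proof.
rewrite (eq_integral (fun t : measurableTypeR R =>
  (((a / 3) *: 'X^3 : {poly R})^`().[t])%:E)); last first.
  move=> t _; rewrite derivZ derivXn hornerZ hornerMn hornerXn; congr (_%:E).
  by rewrite -mulr_natr; field.
rewrite integral_deriv_poly ?ler01// !hornerZ !hornerXn expr1n expr0n/=.
by congr (_%:E); ring.
Qed.

Let measurable_EFin_scaled y :
  measurable_fun setT (fun t : measurableTypeR R => (scaled y t)%:E).
Proof. by apply/measurable_EFinP; exact: measurable_scaled. Qed.

Lemma integral_uniform01_scaled_funepos (y : R) :
  \int[unif]_t ((fun z : R => z%:E)^\+ (scaled y t)) = (Num.max y 0 / 2)%:E.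
Proof.
rewrite integral_uniform01//; last first.
  rewrite (_ : (fun=> _) = (fun t => (scaled y t)%:E)^\+); last first.
    by apply/funext => t; rewrite !funeposE.
  exact: measurable_funepos.
rewrite -integral01_id; apply: eq_integral => t; rewrite inE/= in_itv/= => /andP[t0 _].
by rewrite funeposE -EFin_max maxr_pMr// mulr0.
Qed.

Lemma integral_uniform01_scaled_funeneg (y : R) :
  \int[unif]_t ((fun z : R => z%:E)^\- (scaled y t)) = (Num.max (- y) 0 / 2)%:E.
Proof.
rewrite integral_uniform01//; last first.
  rewrite (_ : (fun=> _) = (fun t => (scaled y t)%:E)^\-); last first.
    by apply/funext => t; rewrite !funenegE.
  exact: measurable_funeneg.
rewrite -integral01_id; apply: eq_integral => t; rewrite inE/= in_itv/= => /andP[t0 _].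
by rewrite funenegE -EFinN -EFin_max /scaled -mulrN maxr_pMr// mulr0.
Qed.

Lemma integral_uniform01_scaled_sqr (y : R) :
  \int[unif]_t ((scaled y t ^+ 2)%R)%:E = (y ^+ 2 / 3)%:E.
Proof.
rewrite integral_uniform01; last 2 first.
- by apply/measurable_EFinP; apply: measurable_funX; exact: measurable_scaled.
- by move=> t; rewrite lee_fin sqr_ge0.
by rewrite -integral01_sqr; apply: eq_integral => t _; rewrite /scaled exprMn.
Qed.

End uniform_scaling.


Section mixture.
Context d (T : measurableType d) (R : realType) (P : probability T R).
Local Open Scope ereal_scope.
Variables (U Y Z : {RV P >-> R}) (y1 y2 y3 p1 p2 p3 : R).
Hypotheses (unifU : uniform01 U) (threeY : three_point Y y1 p1 y2 p2 y3 p3).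
Hypotheses (y12 : y1 != y2) (y13 : y1 != y3) (y23 : y2 != y3).
Hypotheses (indep : independent_RVs U Y) (ZE : forall w, Z w = (U w * Y w)%R).

Local Notation unif := (uniform_prob (@ltr01 R)).

Lemma three_point_ge0 : [/\ (0 <= p1)%R, (0 <= p2)%R & (0 <= p3)%R].
Proof.
by case: threeY => h1 h2 h3 _; rewrite -!lee_fin -h1 -h2 -h3; split.
Qed.

(** On the event [Y = y] the variable [Z] is [U y], and independence lets [U] keep
    its uniform law there. *)
Lemma law_mixture (A : set (measurableTypeR R)) : measurable A ->
  law Z A = p1%:E * unif (scaled y1 @^-1` A) + (p2%:E * unif (scaled y2 @^-1` A)
    + p3%:E * unif (scaled y3 @^-1` A)).
Proof.
move=> mA; have [h1 h2 h3 hae] := threeY.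
have part y p : P [set w | Y w = y] = p%:E ->
    P (Z @^-1` A `&` Y @^-1` [set y]) = p%:E * unif (scaled y @^-1` A).
  move=> hp; have mAy : measurable (scaled y @^-1` A : set (measurableTypeR R)).
    by rewrite -[X in measurable X]setTI; exact: measurable_scaled.
  have -> : Z @^-1` A `&` Y @^-1` [set y] =
      U @^-1` (scaled y @^-1` A) `&` Y @^-1` [set y].
    by apply/seteqP; split => w [ZA Yw]; split => //; move: ZA;
      rewrite /= /scaled ZE (Yw : Y w = y).
  rewrite indep//.
  rewrite muleC; congr (_ * _); [exact: hp|exact: unifU].
have mC y : measurable (Y @^-1` [set y]) by exact: measurable_funPTI.
have mZA : measurable (Z @^-1` A) by exact: measurable_funPTI.
rewrite -!part//.
have null : P (~` (Y @^-1` [set y1] `|` (Y @^-1` [set y2] `|` Y @^-1` [set y3]))) = 0.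
  case: hae => N [mN PN sub].
  apply/eqP; rewrite eq_le measure_ge0 andbT -PN le_measure ?inE//.
    by apply: measurableC; apply: measurableU => //; exact: measurableU.
  by apply: subset_trans sub => w /= h h'; apply: h; case: h'; [left|right; left|right; right].
set C := (_ `|` _) in null.
have mCC : measurable C.
  by apply: measurableU => //; exact: measurableU.
have null' : P (Z @^-1` A `&` ~` C) = 0.
  apply/eqP; rewrite eq_le measure_ge0 andbT -null le_measure ?inE//.
    by apply: measurableI => //; exact: measurableC.
  exact: measurableC.
transitivity (P (Z @^-1` A `&` C)).
  transitivity (P (Z @^-1` A)) => //.
  rewrite -[X in P X = _](setIT (Z @^-1` A)) -(setUv C) setIUr measureU.
  - by rewrite -[RHS]adde0; congr (_ + _).
  - exact: measurableI.
  - by apply: measurableI => //; exact: measurableC.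
  - by rewrite setIACA setICr setI0.
rewrite /C setIUr measureU; last 3 first.
- exact: measurableI.
- by apply: measurableI => //; exact: measurableU.
- rewrite -subset0 => w [[_ /= e1]] [_ [/= e2|/= e3]].
  + by move: y12; rewrite -e1 -e2 eqxx.
  + by move: y13; rewrite -e1 -e3 eqxx.
congr (_ + _); rewrite setIUr measureU//; try exact: measurableI.
rewrite -subset0 => w [[_ /= e2]] [_ /= e3].
by move: y23; rewrite -e2 -e3 eqxx.
Qed.

Lemma ge0_integral_mixture (f : measurableTypeR R -> \bar R) :
  measurable_fun setT f -> (forall z, 0 <= f z) ->
  \int[P]_w f (Z w) = p1%:E * \int[unif]_t f (scaled y1 t) +
   (p2%:E * \int[unif]_t f (scaled y2 t) + p3%:E * \int[unif]_t f (scaled y3 t)).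
Proof.
move=> mf f0; have [p10 p20 p30] := three_point_ge0.
transitivity (\int[law Z]_z f z); first by rewrite ge0_integral_law// preimage_setT.
pose nu y := distribution unif (scaled y).
pose mix := measure_add (mscale (NngNum p10) (nu y1))
  (measure_add (mscale (NngNum p20) (nu y2)) (mscale (NngNum p30) (nu y3))).
rewrite (eq_measure_integral mix); last first.
  move=> A mA _; apply: (etrans (law_mixture mA)); apply/esym.
  by apply: (etrans (measure_addE _ _ _)); congr (_ + _); exact: measure_addE.
rewrite !ge0_integral_measure_add// !ge0_integral_mscale//.
by rewrite !ge0_integral_pushforward.
Qed.

End mixture.

Section max_affine.
Context {R : realType}.

Lemma convex_function_max_affine (D : set R) (f : R -> R) (a : R)
    (p1 p2 p3 b1 b2 b3 c1 c2 c3 : R) :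
  0 <= p1 -> 0 <= p2 -> 0 <= p3 ->
  (forall x y t, D x -> D y -> 0 <= t <= 1 -> D (t * x + (1 - t) * y)) ->
  (forall x, D x -> f x = p1 * Num.max a (b1 * x + c1)
     + (p2 * Num.max a (b2 * x + c2) + p3 * Num.max a (b3 * x + c3))) ->
  @convex_function R R^o D f.
Proof.
move=> p10 p20 p30 cD fE t x y; rewrite !inE => Dx Dy.
have t0 : 0 <= t%:num by [].
have t1 : t%:num <= 1 by [].
have t01 : 0 <= t%:num <= 1 by rewrite t0 t1.
have Dz := cD _ _ _ Dx Dy t01.
rewrite [X in f X](_ : _ = t%:num * x + (1 - t%:num) * y)// convRE/=.
rewrite /unstable.onem (fE _ Dx) (fE _ Dy) (fE _ Dz).
have M b c : Num.max a (b * (t%:num * x + (1 - t%:num) * y) + c) <=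
    t%:num * Num.max a (b * x + c) + (1 - t%:num) * Num.max a (b * y + c).
  rewrite ge_max; apply/andP; split.
    rewrite [leLHS](_ : _ = t%:num * a + (1 - t%:num) * a); last by ring.
    by rewrite lerD// ler_wpM2l// ?subr_ge0// le_max lexx.
  rewrite [leLHS](_ : _ = t%:num * (b * x + c) + (1 - t%:num) * (b * y + c)); last by ring.
  by rewrite lerD// ler_wpM2l// ?subr_ge0// le_max lexx orbT.
have := ler_wpM2l p10 (M b1 c1); have := ler_wpM2l p20 (M b2 c2).
have := ler_wpM2l p30 (M b3 c3); lra.
Qed.

End max_affine.

Section mixture_consequences.
Context d (T : measurableType d) (R : realType) (P : probability T R).
Local Open Scope ereal_scope.
Variables (U Y Z : {RV P >-> R}) (y1 y2 y3 p1 p2 p3 : R).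
Hypotheses (unifU : uniform01 U) (threeY : three_point Y y1 p1 y2 p2 y3 p3).
Hypotheses (y12 : y1 != y2) (y13 : y1 != y3) (y23 : y2 != y3).
Hypotheses (indep : independent_RVs U Y) (ZE : forall w, Z w = (U w * Y w)%R).

Let law_mixtureE := law_mixture unifU threeY y12 y13 y23 indep ZE.
Let integral_mixtureE := ge0_integral_mixture unifU threeY y12 y13 y23 indep ZE.

Lemma expectation_mixture : 'E_P[Z] = ((p1 * y1 + p2 * y2 + p3 * y3) / 2)%:E.
Proof.
have mE : measurable_fun setT (fun z : measurableTypeR R => z%:E).
  exact/measurable_EFinP.
rewrite expectation.unlock integralE.
rewrite (eq_integral (fun w => (fun z : measurableTypeR R => z%:E)^\+ (Z w))); last first.
  by move=> w _; rewrite !funeposE.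
rewrite [X in _ - X](eq_integral (fun w => (fun z : measurableTypeR R => z%:E)^\- (Z w))); last first.
  by move=> w _; rewrite !funenegE.
rewrite !integral_mixtureE//; [|exact: measurable_funeneg|exact: measurable_funepos].
rewrite !integral_uniform01_scaled_funepos !integral_uniform01_scaled_funeneg.
rewrite -!EFinM -!EFinD -?EFinN; congr (_%:E).
have M (y : R) : (Num.max y 0 = y + Num.max (- y) 0)%R.
  by case: (leP y 0%R) => h; case: (leP (- y)%R 0%R) => h'; lra.
by rewrite (M y1) (M y2) (M y3); field.
Qed.

Lemma second_moment_mixture :
  \int[P]_w ((Z w ^+ 2)%R)%:E =
  ((p1 * y1 ^+ 2 + p2 * y2 ^+ 2 + p3 * y3 ^+ 2) / 3)%:E.
Proof.
rewrite (@integral_mixtureE (fun z : measurableTypeR R => ((z ^+ 2)%R)%:E)).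
- rewrite !integral_uniform01_scaled_sqr.
  by rewrite -!EFinM -!EFinD; congr (_%:E); ring.
- by apply/measurable_EFinP; exact: measurable_funX.
- by move=> z; rewrite lee_fin sqr_ge0.
Qed.

Lemma unimodal_mixture : unimodal Z 0.
Proof.
have [p10 p20 p30] := three_point_ge0 threeY.
have cdfE x : cdf Z x = law Z `]-oo, x]%classic by [].
split.
- pose b (y : R) := (if (y < 0)%R then - y^-1 else 0)%R.
  pose c (y : R) := (if (y < 0)%R then 1 else 0)%R : R.
  apply: (@convex_function_max_affine R _ _ 0%R p1 p2 p3 (b y1) (b y2) (b y3)
    (c y1) (c y2) (c y3) p10 p20 p30).
    move=> x y t /=; rewrite !in_itv/= => x0 y0 /andP[t0 t1].
    have [t00|t00] := ltP 0%R t.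
      by rewrite ltr_wnDr ?nmulr_llt0// nmulr_lle0//; lra.
    have -> : t = 0%R by lra.
    by rewrite mul0r add0r subr0 mul1r.
  move=> x /=; rewrite in_itv/= => x0.
  by rewrite cdfE law_mixtureE// !uniform01_scaled_cdf_neg.
- pose b (y : R) := (if (0 < y)%R then - y^-1 else 0)%R.
  pose c (y : R) := (if (0 < y)%R then 0 else - 1)%R : R.
  apply: (@convex_function_max_affine R _ _ (-1)%R p1 p2 p3 (b y1) (b y2) (b y3)
    (c y1) (c y2) (c y3) p10 p20 p30).
    move=> x y t /=; rewrite !in_itv/= !andbT => x0 y0 /andP[t0 t1].
    by rewrite addr_ge0// mulr_ge0// subr_ge0.
  move=> x /=; rewrite in_itv/= andbT => x0.
  by rewrite cdfE law_mixtureE// !uniform01_scaled_cdf_ge0//= !mulrN !opprD !opprK.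
Qed.

Lemma tail_mixture (u v : R) : (0 < u)%R -> (0 < v)%R ->
  (y1 < - u)%R -> (- u < y2)%R -> (y2 < v)%R -> (v < y3)%R ->
  P [set w | (Z w <= - u \/ v <= Z w)%R] =
  (p1 * (1 - u / - y1) + p3 * (1 - v / y3))%:E.
Proof.
move=> u0 v0 h1 h2 h2' h3.
transitivity (law Z [set z | (z <= - u \/ v <= z)%R]) => //.
rewrite law_mixtureE; last first.
  rewrite (_ : mkset _ = `]-oo, (- u)%R] `|` `[v, +oo[); first exact: measurableU.
  by apply/seteqP; split => z /=; rewrite !in_itv/= andbT.
rewrite uniform01_scaled_left_tail// uniform01_scaled_no_tail// uniform01_scaled_right_tail//.
by rewrite mule0 add0e -!EFinM -!EFinD.
Qed.

End mixture_consequences.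

(** * Existence of the extremal variables *)

Section three_point_space.
Context {R : realType}.
Local Open Scope ereal_scope.
Variables (y1 y2 y3 : R) (p1 p2 p3 : {nonneg R}).
Hypotheses (y12 : y1 != y2) (y13 : y1 != y3) (y23 : y2 != y3).
Hypothesis psum : (p1%:num + p2%:num + p3%:num = 1)%R.

Let at_ (y : R) := @dirac _ (measurableTypeR R) y R.

Let atoms : set (measurableTypeR R) -> \bar R :=
  measure_add (mscale p1 (at_ y1)) (measure_add (mscale p2 (at_ y2)) (mscale p3 (at_ y3))).

HB.instance Definition _ := Measure.on atoms.

Let atomsE (A : set (measurableTypeR R)) :
  atoms A = (p1%:num * \1_A y1 + (p2%:num * \1_A y2 + p3%:num * \1_A y3))%:E.
Proof.
apply: (etrans (measure_addE _ _ _)); rewrite !EFinD; congr (_ + _).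
exact: (etrans (measure_addE _ _ _)).
Qed.

Let atomsT : atoms setT = 1.
Proof.
by rewrite atomsE !indicE !in_setT !mulr1 addrA psum.
Qed.

HB.instance Definition _ := Measure_isProbability.Build _ _ _ atoms atomsT.

Let S := (measurableTypeR R * measurableTypeR R)%type.

Let joint : set S -> \bar R := (uniform_prob (@ltr01 R) \x atoms).

HB.instance Definition _ := Measure.on joint.

Let jointT : joint setT = 1.
Proof.
have -> : joint setT = uniform_prob (@ltr01 R) setT * atoms setT.
  by rewrite -setXTT; exact: product_measure1E.
rewrite atomsT mule1.
exact: (@probability_setT _ _ _ (uniform_prob (@ltr01 R))).
Qed.

HB.instance Definition _ := Measure_isProbability.Build _ _ _ joint jointT.

Let U (w : S) : R := w.1.
Let Y (w : S) : R := w.2.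

Let mU : measurable_fun setT U.
Proof. by move=> mT A mA; exact: (@measurable_fst _ _ (measurableTypeR R) (measurableTypeR R) mT A mA). Qed.

Let mY : measurable_fun setT Y.
Proof. by move=> mT A mA; exact: (@measurable_snd _ _ (measurableTypeR R) (measurableTypeR R) mT A mA). Qed.

HB.instance Definition _ := isMeasurableFun.Build _ _ _ _ U mU.
HB.instance Definition _ := isMeasurableFun.Build _ _ _ _ Y mY.

Lemma uniform_three_point_exists :
  exists (d : measure_display) (T : measurableType d) (P : probability T R)
    (U Y : {RV P >-> R}),
  [/\ uniform01 U, three_point Y y1 p1%:num y2 p2%:num y3 p3%:num &
      independent_RVs U Y].
Proof.
have PX (A B : set (measurableTypeR R)) : measurable A -> measurable B ->
    joint (A `*` B) = uniform_prob (@ltr01 R) A * atoms B.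
  exact: product_measure1E.
have PU (A : set (measurableTypeR R)) : measurable A ->
    joint (U @^-1` A) = uniform_prob (@ltr01 R) A.
  move=> mA; have -> : U @^-1` A = A `*` setT.
    by apply/seteqP; split => w; [move=> ?; split|case].
  by rewrite PX// atomsT mule1.
have PY (B : set (measurableTypeR R)) : measurable B ->
    joint (Y @^-1` B) = atoms B.
  move=> mB; have -> : Y @^-1` B = setT `*` B.
    by apply/seteqP; split => w; [move=> ?; split|case].
  rewrite PX// (@probability_setT _ _ _ (uniform_prob (@ltr01 R))).
  by rewrite mul1e.
exists _, S, joint, U, Y; split.
- by move=> A mA; exact: PU.
- have PY1 y : joint [set w | Y w = y] = atoms [set y].
    exact: (PY [set y] (measurable_set1 y)).
  split.
  + apply: (etrans (PY1 _)); rewrite atomsE !indicE !in_set1 eqxx (eq_sym y2) (eq_sym y3).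
    by rewrite (negbTE y12) (negbTE y13) mulr1 !mulr0 !addr0.
  + apply: (etrans (PY1 _)); rewrite atomsE !indicE !in_set1 eqxx (eq_sym y3).
    by rewrite (negbTE y12) (negbTE y23) mulr1 !mulr0 add0r addr0.
  + apply: (etrans (PY1 _)); rewrite atomsE !indicE !in_set1 eqxx.
    by rewrite (negbTE y13) (negbTE y23) mulr1 !mulr0 !add0r.
  + pose E : set (measurableTypeR R) := [set y1] `|` ([set y2] `|` [set y3]).
    have mE : measurable E.
      by apply: measurableU; [|apply: measurableU]; exact: measurable_set1.
    exists (Y @^-1` (~` E)); split.
    * by rewrite -[X in measurable X]setTI; apply: mY => //; exact: measurableC.
    * rewrite [LHS](PY _ (measurableC mE)) atomsE !indicE !memNset ?mulr0 ?addr0//.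
      - by move=> h; apply: h; right; right.
      - by move=> h; apply: h; right; left.
      - by move=> h; apply: h; left.
    * by move=> w /= h [e|[e|e]]; apply: h; [exact: Or31|exact: Or32|exact: Or33].
- move=> A B mA mB.
  transitivity (uniform_prob (@ltr01 R) A * atoms B); first exact: PX.
  by congr (_ * _); apply/esym; [exact: PU|exact: PY].
Qed.

End three_point_space.

(** * The sharp inequality *)

Theorem theorem6p3 (R : realType) (u v gamma c bound : R)
  (huv : (Num.sqrt 3 <= u /\ u <= v /\ v <= u + 2 / u) \/
         (Num.sqrt 3 <= v /\ v <= u /\ u <= v + 2 / v))
  (hgamma : gamma = 2 * Num.sqrt (1 + u / v)
                      * cos (1 / 3 * (pi - atan (Num.sqrt (u / v)))) - 1)
  (hc : c = 3 / 8 * (gamma + 3) * v)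
  (hbound : bound =
     (1024 * v ^- 2 + 27 * (gamma - 1) ^+ 2 * (gamma + 3) ^+ 2)
       / (9 * (gamma + 3) ^+ 3 * (3 * gamma + 1))) :
  (forall (d : measure_display) (T : measurableType d) (P : probability T R)
          (Z : {RV P >-> R}),
     'E_P[Z]%E = 0%E -> 'V_P[Z]%E = 1%E -> unimodal Z 0 ->
     (P [set w | (Z w <= - u \/ v <= Z w)%R] <= bound%:E)%E)
  /\
  (exists (d : measure_display) (T : measurableType d) (P : probability T R)
          (U Y : {RV P >-> R}), extremal_pair gamma c U Y)
  /\
  (forall (d : measure_display) (T : measurableType d) (P : probability T R)
          (U Y Z : {RV P >-> R}),
     extremal_pair gamma c U Y -> (forall w, Z w = U w * Y w) ->
     [/\ 'E_P[Z]%E = 0%E, 'V_P[Z]%E = 1%E, unimodal Z 0 &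
         P [set w | Z w <= - u \/ v <= Z w] = bound%:E]).
Proof.
have s3 : 0 < Num.sqrt 3 :> R by rewrite sqrtr_gt0.
have u0 : 0 < u by case: huv => -[? [? _]]; lra.
have v0 : 0 < v by case: huv => -[? [? _]]; lra.
have [g0 cubic] := gamma_cubic u0 v0 hgamma.
pose m := 3 / 4 * (1 - gamma) * c.
pose k := 2 * v / (c ^+ 3 * (3 * gamma + 1)).
have H : tangency u v gamma c m k by [].
have c0 := tangency_c_gt0 H.
have right := tangency_right H; have left := tangency_left H.
have [mv vc _ _] := right; have [mu ugc _ _] := left.
have boundE : bound = k * (3 + m ^+ 2) by rewrite hbound (tangency_bound H).
have y12 : - gamma * c != m by rewrite lt_eqF//; lra.
have y13 : - gamma * c != c by rewrite lt_eqF//; lra.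
have y23 : m != c by rewrite lt_eqF//; lra.
split; [|split].
- move=> d T P Z Z0 Z1 uni; rewrite boundE.
  exact: (unimodal_tail_bound Z0 Z1 uni (tangency_k_gt0 H) u0 v0 right left).
- have [p10 p20 p30] := weights_ge0 H erefl erefl erefl huv.
  have psum := weights_sum H erefl erefl erefl.
  have [d [T [P [U [Y [? ? ?]]]]]] := @uniform_three_point_exists R _ _ _
    (NngNum p10) (NngNum p20) (NngNum p30) y12 y13 y23 psum.
  by exists d, T, P, U, Y.
- move=> d T P U Y Z [unifU threeY indep] ZE.
  have EZ : 'E_P[Z]%E = 0%E.
    rewrite (expectation_mixture unifU threeY y12 y13 y23 indep ZE).
    by rewrite (weights_mean H erefl erefl erefl) mul0r.
  split => //.
  + rewrite variance_centered//.
    rewrite (second_moment_mixture unifU threeY y12 y13 y23 indep ZE).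
    by rewrite (weights_second_moment H erefl erefl erefl) divff.
  + exact: (unimodal_mixture unifU threeY y12 y13 y23 indep ZE).
  + have t1 : - gamma * c < - u by lra.
    have t2 : - u < m by lra.
    rewrite (tail_mixture unifU threeY y12 y13 y23 indep ZE u0 v0 t1 t2 mv vc).
    rewrite mulNr opprK boundE.
    by rewrite (weights_tail H erefl erefl erefl).
Qed.
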